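(* Let $\Pi$ be a proper and irreducible (grouped) permutation on a countably infinite alphabet $\mathcal A\cong\mathbb N$. Then the set of lengths $\lambda\in\Delta$ for which the IET $T_{(\Pi,\lambda)}$ is uniquely ergodic contains a dense $G_\delta$ subset of $\Delta$ with respect to the $\ell^1$-topology.
   Context: **Simplex.** $\mathcal A$ is identified with $\mathbb N$ by a fixed bijection, and $\Delta=\{\lambda\in\mathbb R_{>0}^{\mathbb N}:\sum_i\lambda_i=1\}$ with the topology induced by the $\ell^1$-norm. **Grouped permutations.** A (grouped) permutation $\Pi=(\mathcal P,\tau,\pi)$ on $\mathcal A$ consists of: a finite partition $\mathcal P$ of $\mathcal A$ into $d\ge 2$ groups, each of cardinality $1$ (a single interval) or infinite (a tail interval, or tail); a map $\tau:\mathcal P\to\{\leftarrow,\bullet,\rightarrow\}$ equal to $\bullet$ exactly on single intervals, a tail being called right-sided if $\tau=\leftarrow$ and left-sided if $\tau=\rightarrow$; a pair $\pi=(\pi_t,\pi_b)$ of bijections $\mathcal P\to\{1,\dots,d\}$. Each tail also carries an enumeration $\alpha_1,\alpha_2,\dots$ of its labels, from the outermost label inwards. **The IET $T_{(\Pi,\lambda)}$.** For $\lambda\in\Delta$, partition $[0,1]$ (up to a countable set) into open top intervals $I^t_\alpha$ and into open bottom intervals $I^b_\alpha$, with $|I^t_\alpha|=|I^b_\alpha|=\lambda_\alpha$, as follows. The top (bottom) intervals of each group are placed contiguously, and the groups appear from left to right in the order $\pi_t^{-1}(1),\dots,\pi_t^{-1}(d)$ (resp. $\pi_b^{-1}(1),\dots,\pi_b^{-1}(d)$).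 On top, the intervals of a left-sided tail appear from left to right in the order $\alpha_1,\alpha_2,\dots$ (accumulating at the right end of the group), those of a right-sided tail appear from right to left in the order $\alpha_1,\alpha_2,\dots$ (accumulating at the left end). On the bottom the order inside each tail is reversed. $T_{(\Pi,\lambda)}$ is the map which translates each $I^t_\alpha$ onto $I^b_\alpha$; its values on the countable complement of $\bigsqcup_\alpha I^t_\alpha$ play no role, so $T$ is regarded as defined on $\bigsqcup_\alpha I^t_\alpha$. **Proper and irreducible.** $\Pi$ is proper if at least one of the groups $\pi_t^{-1}(1),\pi_b^{-1}(1)$ and at least one of the groups $\pi_t^{-1}(d),\pi_b^{-1}(d)$ is a single interval. $\Pi$ is irreducible if $\pi_t^{-1}(\{1,\dots,n\})\ne\pi_b^{-1}(\{1,\dots,n\})$ for every $1\le n<d$. **Unique ergodicity.** $T$ is uniquely ergodic if there is a unique $T$-invariant Borel probability measure on $[0,1]$ (invariance: $\mu(T^{-1}(A))=\mu(A)$ for all Borel $A$). *)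

(* Defs.v *)
(* MathComp-Analysis. *)
From HB Require Import structures.
From mathcomp Require Import all_boot all_order all_algebra.
From mathcomp Require Import all_classical all_reals all_analysis.

Set Implicit Arguments.
Unset Strict Implicit.
Unset Printing Implicit Defensive.

Import Order.TTheory GRing.Theory Num.Theory.
Import numFieldNormedType.Exports.

Local Open Scope classical_set_scope.
Local Open Scope ring_scope.

(* TowardsLeft is the arrow <-, Single the bullet, TowardsRight the arrow ->.
   The arrow of a tail points to the end of the group at which its top
   intervals accumulate: TowardsRight is a left-sided tail, TowardsLeft a
   right-sided one. *)
Inductive group_kind := TowardsLeft | Single | TowardsRight.

(* The alphabet is nat.  The partition is given by its finite type of groups
   and by the map sending a letter to its group.  Positions and enumerations
   are numbered from 0.  Only the enumerations of tails are constrained (and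
   used). *)
Record grouped_permutation := GroupedPermutation {
  groups : finType;
  group_of : nat -> groups;
  kind : groups -> group_kind;
  pos_top : groups -> 'I_#|groups|;
  pos_bot : groups -> 'I_#|groups|;
  label : groups -> nat -> nat;
  card_groups_ge2 : (2 <= #|groups|)%N;
  group_single_or_infinite : forall g,
    (exists a, group_of @^-1` [set g] = [set a]) \/
    infinite_set (group_of @^-1` [set g]);
  kind_single : forall g,
    kind g = Single <-> exists a, group_of @^-1` [set g] = [set a];
  pos_top_bij : bijective pos_top;
  pos_bot_bij : bijective pos_bot;
  label_enum : forall g, kind g <> Single ->
    set_bij [set: nat] (group_of @^-1` [set g]) (label g)
}.

Definition is_proper (Pi : grouped_permutation) : Prop :=
  (exists2 g : groups Pi, kind g = Single &
     pos_top g = 0%N :> nat \/ pos_bot g = 0%N :> nat) /\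
  (exists2 g : groups Pi, kind g = Single &
     pos_top g = #|groups Pi|.-1 :> nat \/ pos_bot g = #|groups Pi|.-1 :> nat).

Definition is_irreducible (Pi : grouped_permutation) : Prop :=
  forall n : nat, (1 <= n < #|groups Pi|)%N ->
    [set g : groups Pi | (pos_top g < n)%N]%SET <>
    [set g : groups Pi | (pos_bot g < n)%N]%SET.

(* [a] is strictly more outward than [b] in the enumeration of the tail [g]. *)
Definition outer (Pi : grouped_permutation) (g : groups Pi) (a b : nat) : Prop :=
  exists i j : nat, [/\ (i < j)%N, a = label g i & b = label g j].

(* [a] lies to the left of [b] among the top intervals of the tail [g]. *)
Definition left_in_tail (Pi : grouped_permutation) (g : groups Pi)
    (a b : nat) : Prop :=
  match kind g with
  | TowardsRight => outer g a b
  | TowardsLeft => outer g b a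
  | Single => False
  end.

Definition left_top (Pi : grouped_permutation) (a b : nat) : Prop :=
  (pos_top (group_of Pi a) < pos_top (group_of Pi b))%N \/
  (group_of Pi a = group_of Pi b /\ left_in_tail (group_of Pi a) a b).

(* On the bottom the order inside each tail is reversed. *)
Definition left_bot (Pi : grouped_permutation) (a b : nat) : Prop :=
  (pos_bot (group_of Pi a) < pos_bot (group_of Pi b))%N \/
  (group_of Pi a = group_of Pi b /\ left_in_tail (group_of Pi a) b a).

Record simplex (R : realType) := Simplex {
  len :> nat -> R;
  len_gt0 : forall i, 0 < len i;
  len_sum : (\sum_(0 <= i <oo) (len i)%:E = 1)%E
}.

Section l1_metric.
Context {R : realType}.
Implicit Types lam mu nu : simplex R.

HB.instance Definition _ := gen_eqMixin (simplex R).
HB.instance Definition _ := gen_choiceMixin (simplex R).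

Definition l1_dist lam mu : R :=
  fine (\sum_(0 <= i <oo) `|lam i - mu i|%:E)%E.

Let l1_fin lam mu :
  (\sum_(0 <= i <oo) `|lam i - mu i|%:E)%E \is a fin_num.
Proof.
rewrite ge0_fin_numE; last by apply: nneseries_ge0 => i _ _; rewrite lee_fin.
apply: (@le_lt_trans _ _ (\sum_(0 <= i <oo) ((lam i)%:E + (mu i)%:E))%E).
  apply: lee_nneseries => i _; first by rewrite lee_fin.
  rewrite -EFinD lee_fin (le_trans (ler_normB _ _))//.
  by rewrite !gtr0_norm ?len_gt0.
by rewrite nneseriesD ?len_sum ?ltry// => i _ _; rewrite lee_fin ltW ?len_gt0.
Qed.

Let l1_distxx lam : l1_dist lam lam = 0.
Proof. by rewrite /l1_dist eseries0// => i _ _; rewrite subrr normr0. Qed.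

Let l1_dist_positivity lam mu : l1_dist lam mu = 0 -> lam = mu.
Proof.
move=> lm0.
have {}lm0 : (\sum_(0 <= i <oo) `|lam i - mu i|%:E = 0)%E.
  by rewrite -[LHS]fineK// -/(l1_dist lam mu) lm0.
have lm : len lam = len mu.
  apply/funext => k; apply/eqP; rewrite -subr_eq0 -normr_le0 -lee_fin -[leRHS]lm0.
  apply: le_trans (nneseries_lim_ge k.+1 _); last by move=> *; rewrite lee_fin.
  by rewrite big_nat_recr//= leeDr// sume_ge0// => i _; rewrite lee_fin.
case: lam mu lm {lm0} => l l0 l1 [m m0 m1] /= lm; subst m.
by congr Simplex; exact: Prop_irrelevance.
Qed.

Let l1_dist_sym lam mu : l1_dist lam mu = l1_dist mu lam.
Proof. by congr fine; apply: eq_eseriesr => i _; rewrite distrC. Qed.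

Let l1_dist_triangle mu lam nu :
  l1_dist lam nu <= l1_dist lam mu + l1_dist mu nu.
Proof.
rewrite -fineD// fine_le// ?fin_numD ?l1_fin//.
rewrite -nneseriesD//.
apply: lee_nneseries => i _; first by rewrite lee_fin.
by rewrite -EFinD lee_fin ler_distD.
Qed.

(* [simplex R] carries the topology of the l^1 distance. *)
HB.instance Definition _ := isMetric.Build R (simplex R)
  l1_distxx l1_dist_positivity l1_dist_sym l1_dist_triangle.

End l1_metric.

Section iet.
Context {R : realType} (Pi : grouped_permutation) (lam : simplex R).

Definition top_left (a : nat) : R :=
  fine (\esum_(b in [set b | left_top Pi b a]) (lam b)%:E)%E.

Definition bot_left (a : nat) : R :=
  fine (\esum_(b in [set b | left_bot Pi b a]) (lam b)%:E)%E.

Definition top_itv (a : nat) : set R :=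
  `]top_left a, (top_left a + lam a)[%classic.

Definition iet_dom : set R := \bigcup_a top_itv a.

(* Only meaningful on [iet_dom]. *)
Definition iet (x : R) : R :=
  xget 0 [set y | exists2 a, top_itv a x & y = x - top_left a + bot_left a].

(* Borel probability measures on [0, 1] are Borel probability measures on the
   line which give full mass to [0, 1].  The IET is a partial map, hence the
   preimages are taken inside its domain. *)
Definition iet_invariant (mu : probability (measurableTypeR R) R) : Prop :=
  mu `[0, 1]%classic = 1%E /\
  forall A : set (measurableTypeR R), measurable A ->
    mu (iet_dom `&` iet @^-1` A) = mu A.

Definition uniquely_ergodic : Prop :=
  exists mu : probability (measurableTypeR R) R,
    iet_invariant mu /\
    forall nu : probability (measurableTypeR R) R, iet_invariant nu ->
      forall A : set (measurableTypeR R), measurable A -> nu A = mu A.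

End iet.

(* Main.v *)
Require Import Defs.
From mathcomp Require Import all_boot all_order all_algebra.
From mathcomp Require Import all_classical all_reals all_analysis borel_hierarchy.
From mathcomp Require Import measurable_realfun zify ring lra.

(* Lebesgue measure is invariant under every T_lam, so by a Baire argument in
   the simplex it suffices to find, near every length vector, an open set of
   vectors lam for which all invariant measures of T_lam are nearly uniform.

   Approximate the given vector by omega * c, where c is a finitely supported
   integer vector whose exchange permutes the #|c| cells of width omega
   cyclically.  Such vectors are dense: an arbitrary rational vector gives a
   permutation of cells with several cycles, each sweeping out a cylinder.
   Draw an edge from a cylinder to another one when a cell of the latter is the
   left neighbour of a cell of the former.  Irreducibility makes this graph
   strongly connected, and the cylinders along a simple cycle of it can be merged,
   at the price of a small change of direction, by winding many times around the
   first one, then stepping over to the second one, and so on.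

   Now add a small multiple s * tau of a vector tau for which every letter,
   including those outside the support of c, is moved to the left by T_lam
   relative to the motion of the cells; a combination of the differences of
   bottom and top positions has this property, by irreducibility, and
   properness takes care of the two ends of [0, 1].  For lam close to
   omega * c + s * tau every orbit drifts to the left, modulo omega, at a speed
   between s / 2 and a multiple of s.  Hence it spends a small proportion of the
   time near the grid omega * Z, while away from the grid it follows the
   permutation of the cells, visiting all of them equally often. *)

Set Implicit Arguments.
Unset Strict Implicit.
Unset Printing Implicit Defensive.

Import Order.TTheory GRing.Theory Num.Theory.
Import numFieldNormedType.Exports.

Local Open Scope classical_set_scope.

(** * Orders on the letters *)

(** The model [omega * c] alone only yields a map that permutes the cells rigidly and so has many
    invariant measures; the drift is what forces equidistribution. The obstacle is the infinity of
    letters that the model does not see. About an orbit passing through one of them, little is known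
    beyond this: its displacement is an integer multiple of [omega] minus a drift of order [s]. A
    displacement is a difference of two sums of lengths, possibly over infinitely many letters, and
    each of them deviates from the model by at most [s / 8]. As the drift has a constant sign, an
    orbit that has left a strip around the grid must drift across nearly a whole cell, modulo
    [omega], before it meets such a strip again.

    The constants are chosen in this order: the number of cells, large against the inverse of the
    error; then [s], small against the width of a cell; then the radius of the open set, a fixed
    fraction of [s]. Being nearly uniform is expressed by distribution functions, so that countably
    many conditions suffice.

    The vector [tau] is a variant of the suspension data of Masur and Veech for finite exchanges:
    proper prefix sums are positive in the top order and negative in the bottom order. *)

Section letters.
Variable Pi : grouped_permutation.
Implicit Types (g : groups Pi) (a b c : nat).

Lemma label_inj g : kind g <> Single -> injective (label g).
Proof.
by move=> /label_enum [_ inj _] i j ij; apply: inj ij; rewrite inE.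
Qed.

Lemma label_surj a : kind (group_of Pi a) <> Single ->
  exists i, label (group_of Pi a) i = a.
Proof. by move=> /label_enum [_ _ surj]; have [i _ ia] := surj a erefl; exists i. Qed.

Lemma single_group_eq a b :
  kind (group_of Pi a) = Single -> group_of Pi a = group_of Pi b -> a = b.
Proof.
move=> /kind_single [c /seteqP[sub _]] ab.
by have -> : a = c by [apply: sub]; rewrite (sub b)//= -ab.
Qed.

Lemma outer_irr g a : kind g <> Single -> ~ outer g a a.
Proof. by move=> /label_inj inj [i [j [ij -> /inj]]] ji; rewrite ji ltnn in ij. Qed.

Lemma outer_trans g a b c : kind g <> Single ->
  outer g a b -> outer g b c -> outer g a c.
Proof.
move=> /label_inj inj [i [j [ij -> ->]]] [k [l [kl /inj jk ->]]].
by exists i, l; split=> //; apply: ltn_trans ij _; rewrite jk.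
Qed.

Lemma outer_total a b : kind (group_of Pi a) <> Single ->
  group_of Pi a = group_of Pi b ->
  [\/ a = b, outer (group_of Pi a) a b | outer (group_of Pi a) b a].
Proof.
move=> ns ab; have [i ia] := label_surj ns.
have [|j] := @label_surj b; first by rewrite -ab.
rewrite -ab => jb.
have [ij|ji|ij] := ltngtP i j.
- by apply: Or32; exists i, j.
- by apply: Or33; exists j, i.
- by apply: Or31; rewrite -ia -jb ij.
Qed.

Lemma left_in_tail_irr g a : ~ left_in_tail g a a.
Proof.
by rewrite /left_in_tail; case E : (kind g) => o //; apply: (outer_irr _ o); rewrite E.
Qed.

Lemma left_in_tail_trans g a b c :
  left_in_tail g a b -> left_in_tail g b c -> left_in_tail g a c.
Proof.
rewrite /left_in_tail; case E : (kind g) => ab bc //.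
- by apply: (outer_trans _ bc ab); rewrite E.
- by apply: (outer_trans _ ab bc); rewrite E.
Qed.

Lemma left_in_tail_total a b : group_of Pi a = group_of Pi b ->
  [\/ a = b, left_in_tail (group_of Pi a) a b
    | left_in_tail (group_of Pi a) b a].
Proof.
move=> ab; rewrite /left_in_tail; case E : (kind (group_of Pi a)).
- have [|->|o|o] := outer_total _ ab; first by rewrite E.
  + exact: Or31. + exact: Or33. + exact: Or32.
- by apply: Or31; apply: single_group_eq ab.
- by apply: outer_total => //; rewrite E.
Qed.

Lemma pos_top_inj : injective (@pos_top Pi).
Proof. exact: bij_inj (@pos_top_bij Pi). Qed.

Lemma pos_bot_inj : injective (@pos_bot Pi).
Proof. exact: bij_inj (@pos_bot_bij Pi). Qed.

Lemma left_top_irr a : ~ left_top Pi a a.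
Proof. by case=> [|[_ /left_in_tail_irr//]]; rewrite ltnn. Qed.

Lemma left_bot_irr a : ~ left_bot Pi a a.
Proof. by case=> [|[_ /left_in_tail_irr//]]; rewrite ltnn. Qed.

Lemma left_top_trans a b c : left_top Pi a b -> left_top Pi b c -> left_top Pi a c.
Proof.
case=> [ab|[ab tab]] [bc|[bc tbc]].
- by left; apply: ltn_trans ab bc.
- by left; rewrite -bc.
- by left; rewrite ab.
- by right; split; [rewrite ab|apply: left_in_tail_trans tab _; rewrite ab].
Qed.

Lemma left_bot_trans a b c : left_bot Pi a b -> left_bot Pi b c -> left_bot Pi a c.
Proof.
case=> [ab|[ab tab]] [bc|[bc tbc]].
- by left; apply: ltn_trans ab bc.
- by left; rewrite -bc.
- by left; rewrite ab.
- right; split; first by rewrite ab.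
  by apply: left_in_tail_trans tab; rewrite ab.
Qed.

Lemma left_top_total a b : [\/ a = b, left_top Pi a b | left_top Pi b a].
Proof.
have [ab|ba|/val_inj/pos_top_inj ab] :=
  ltngtP (pos_top (group_of Pi a)) (pos_top (group_of Pi b)).
- by apply: Or32; left.
- by apply: Or33; left.
- have [->|t|t] := left_in_tail_total ab.
  + exact: Or31. + by apply: Or32; right.
  + by apply: Or33; right; split=> //; rewrite -ab.
Qed.

Lemma left_bot_total a b : [\/ a = b, left_bot Pi a b | left_bot Pi b a].
Proof.
have [ab|ba|/val_inj/pos_bot_inj ab] :=
  ltngtP (pos_bot (group_of Pi a)) (pos_bot (group_of Pi b)).
- by apply: Or32; left.
- by apply: Or33; left.
- have [->|t|t] := left_in_tail_total ab.
  + exact: Or31. + by apply: Or33; right; split=> //; rewrite -ab.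
  + by apply: Or32; right.
Qed.

(** The reversal inside tails is used in this form: it shows that an invariant initial segment
    cutting no letter cuts no group either, and that [Lt] and [Lb] exclude each other in
    [drift_weights]. *)
Lemma left_top_bot a b : group_of Pi a = group_of Pi b ->
  left_top Pi a b -> left_bot Pi a b -> False.
Proof.
move=> ab [|[_ t]]; first by rewrite ab ltnn.
case=> [|[_ t']]; first by rewrite ab ltnn.
exact: left_in_tail_irr (left_in_tail_trans t t').
Qed.

Lemma left_top_group a b : group_of Pi a <> group_of Pi b ->
  left_top Pi a b <-> (pos_top (group_of Pi a) < pos_top (group_of Pi b))%N.
Proof. by move=> ab; split=> [[|[]]//|]; left. Qed.

Lemma left_bot_group a b : group_of Pi a <> group_of Pi b ->
  left_bot Pi a b <-> (pos_bot (group_of Pi a) < pos_bot (group_of Pi b))%N.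
Proof. by move=> ab; split=> [[|[]]//|]; left. Qed.

End letters.

(** * Exchanges of finitely many cells *)

Lemma card_ord_prefix d n : (n <= d)%N -> #|[set i : 'I_d | (i < n)%N]%SET| = n.
Proof.
move=> nd; rewrite cardsE -sum1_card.
by rewrite -(big_ord_widen _ (fun=> 1%N) nd) sum_nat_const card_ord muln1.
Qed.

Lemma card_bij_prefix (T : finType) d (f : T -> 'I_d) n : bijective f ->
  (n <= d)%N -> #|[set g | (f g < n)%N]%SET| = n.
Proof.
move=> bijf nd; rewrite -[RHS](card_ord_prefix nd) -(on_card_preimset (f := f));
  last exact: onW_bij.
by apply: eq_card => g; rewrite !inE.
Qed.

Lemma initial_segment_prefix (T : finType) (f : T -> 'I_#|T|) (A : {set T}) :
  bijective f -> (forall g g', g \in A -> g' \notin A -> (f g < f g')%N) ->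
  A = [set g | (f g < #|A|)%N]%SET.
Proof.
move=> bijf Af; apply/eqP; rewrite eqEcard card_bij_prefix ?max_card// leqnn andbT.
apply/fintype.subsetP => g gA; rewrite inE -(card_bij_prefix (n := (f g).+1) bijf)//.
apply: subset_leq_card; apply/fintype.subsetP => h; rewrite inE ltnS => hg.
by apply: contraT => /(Af g h gA); rewrite ltnNge hg.
Qed.

(* [key] is the position of a cell on the line, [lab] the letter of the top
   interval containing it; the exchange moves the cell [x] to [sigma x]. *)
Record discrete_iet (Pi : grouped_permutation) (X : finType)
    (key lab : X -> nat) (sigma : X -> X) : Prop := DiscreteIet {
  key_inj : injective key;
  sigma_inj : injective sigma;
  key_top : forall x y, (key x < key y)%N ->
    lab x = lab y \/ left_top Pi (lab x) (lab y);
  key_bot : forall x y, (key (sigma x) < key (sigma y))%N ->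
    lab x = lab y \/ left_bot Pi (lab x) (lab y);
  key_lab : forall x y, lab x = lab y ->
    (key x < key y)%N -> (key (sigma x) < key (sigma y))%N;
  lab_group : forall g, exists x, group_of Pi (lab x) = g
}.

Section irreducible.
Variables (Pi : grouped_permutation) (Pi_irr : is_irreducible Pi).

(** Otherwise [g] has the same position on both lines and the groups before it form a common prefix.
    If that prefix is empty, [g] itself is a common prefix of length 1. *)
Lemma irreducible_cut (g : groups Pi) :
  ~ (forall h, h <> g ->
     (pos_top h < pos_top g)%N = (pos_bot h < pos_bot g)%N).
Proof.
move=> cut.
have eqp : [set h : groups Pi | (pos_top h < pos_top g)%N]%SET =
           [set h : groups Pi | (pos_bot h < pos_bot g)%N]%SET.
  apply/setP => h; rewrite !inE; have [->|/eqP/cut//] := eqVneq h g.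
  by rewrite !ltnn.
have pos_eq : pos_top g = pos_bot g :> nat.
  rewrite -(card_bij_prefix (@pos_top_bij Pi) (ltnW (ltn_ord (pos_top g)))) eqp.
  by rewrite (card_bij_prefix (@pos_bot_bij Pi) (ltnW (ltn_ord (pos_bot g)))).
have [g0|g0] := posnP (pos_top g); last first.
  by apply: (Pi_irr (n := pos_top g)); rewrite ?g0//= {2}pos_eq.
apply: (Pi_irr (n := 1)); first by rewrite card_groups_ge2.
apply/setP => h; rewrite !inE !ltnS !leqn0.
apply/eqP/eqP => h0.
  have -> : h = g by apply/pos_top_inj/val_inj/(etrans h0 (esym g0)).
  by rewrite -pos_eq.
have -> : h = g by apply/pos_bot_inj/val_inj; rewrite /= h0 -pos_eq.
by rewrite g0.
Qed.

Variables (X : finType) (key lab : X -> nat) (sigma : X -> X).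
Hypothesis D : discrete_iet Pi key lab sigma.

(** The end of a proper such segment cuts both lines at the same place. If the cut splits a letter,
    the group of this letter contradicts [irreducible_cut]. If not, it splits no group either,
    because tails are reversed, and the groups met by [M] are a common prefix. *)
Lemma invariant_initial_segment (M : {set X}) x0 : x0 \in M ->
  (forall x y, y \in M -> (key x < key y)%N -> x \in M) ->
  (forall x, x \in M -> sigma x \in M) -> forall y, y \in M.
Proof.
move=> x0M down inv y0; apply: contraT => y0M; exfalso.
(* By finiteness [sigma] maps [M] onto itself, so the complement is invariant too. *)
have invE x : (sigma x \in M) = (x \in M).
  apply/idP/idP; last exact: inv.
  have {1}-> : M = imset sigma (mem M).
    apply/esym/eqP; rewrite eqEcard card_imset ?leqnn ?andbT; last exact: sigma_inj D.
    by apply/fintype.subsetP => _ /imsetP [y yM ->]; apply: inv.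
  by move=> /imsetP [y yM /(sigma_inj D) ->].
have ltM x y : x \in M -> y \notin M -> (key x < key y)%N.
  move=> xM yM; rewrite ltnNge leq_eqVlt; apply/negP => /orP [/eqP /(key_inj D) yx|yx].
    by rewrite yx xM in yM.
  by rewrite (down _ _ xM yx) in yM.
have [[x [y [xM yM xy]]]|nocut] :=
  pselect (exists x y, [/\ x \in M, y \notin M & lab x = lab y]).
  apply: (@irreducible_cut (group_of Pi (lab x))) => h hx.
  have [z zh] := lab_group D h; rewrite -zh in hx *.
  have zx : lab z <> lab x by move=> zx; rewrite zx in hx.
  apply/idP/idP => [/(left_top_group hx)|/(left_bot_group hx)] lt;
    apply/(left_top_group hx) || apply/(left_bot_group hx).
  - have zM : z \in M.
      apply: contraT => /(ltM _ _ xM) /(key_top D) [/esym//|/(left_top_trans lt)].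
      by move=> /left_top_irr.
    have /(key_bot D)[|] : (key (sigma z) < key (sigma y))%N by apply: ltM; rewrite invE.
      by rewrite -xy.
    by rewrite xy.
  - have zM : z \in M.
      apply: contraT => zM.
      have /(key_bot D)[/esym//|/(left_bot_trans lt)/left_bot_irr//] :
        (key (sigma x) < key (sigma z))%N by apply: ltM; rewrite invE.
    have /(key_top D)[|] : (key z < key y)%N by apply: ltM.
      by rewrite -xy.
    by rewrite xy.
have nogroup x y : x \in M -> y \notin M ->
    left_top Pi (lab x) (lab y) /\ left_bot Pi (lab x) (lab y).
  move=> xM yM; split.
    have [xy|//] := key_top D (ltM _ _ xM yM).
    by case: nocut; exists x, y.
  have /(key_bot D)[xy|//] : (key (sigma x) < key (sigma y))%N by apply: ltM; rewrite invE.
  by case: nocut; exists x, y.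
have nogroupE x y : x \in M -> y \notin M -> group_of Pi (lab x) <> group_of Pi (lab y).
  by move=> xM yM /left_top_bot; have [t b] := nogroup _ _ xM yM; apply.
pose A := [set g | [exists x in M, group_of Pi (lab x) == g]]%SET.
have AM x : group_of Pi (lab x) \in A -> x \in M.
  rewrite inE => /exists_inP [y yM /eqP yx]; apply: contraT => xM.
  by case: (nogroupE _ _ yM xM).
have Alt g h : g \in A -> h \notin A ->
    (pos_top g < pos_top h)%N /\ (pos_bot g < pos_bot h)%N.
  rewrite inE => /exists_inP [x xM /eqP <-]; have [y <-] := lab_group D h => yA.
  have yM : y \notin M.
    apply: contra yA => yM; rewrite inE; apply/exists_inP; exists y => //.
  have [t b] := nogroup _ _ xM yM; have gE := nogroupE _ _ xM yM.
  by split; [apply/(left_top_group gE)|apply/(left_bot_group gE)].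
apply: (Pi_irr (n := #|A|)).
  apply/andP; split.
    apply/card_gt0P; exists (group_of Pi (lab x0)); rewrite inE.
    by apply/exists_inP; exists x0.
  rewrite -cardsT; apply: proper_card; rewrite properT.
  by apply: contraNneq y0M => AT; apply: AM; rewrite AT inE.
transitivity A; [apply/esym|]; apply: initial_segment_prefix.
- exact: pos_top_bij.
- by move=> g h gA /(Alt _ _ gA) [].
- exact: pos_bot_bij.
- by move=> g h gA /(Alt _ _ gA) [].
Qed.

End irreducible.

Section rank.
Variables (X : finType) (r : X -> X -> Prop).
Hypothesis r_irr : forall x, ~ r x x.
Hypothesis r_trans : forall x y z, r x y -> r y z -> r x z.
Hypothesis r_total : forall x y, [\/ x = y, r x y | r y x].

Definition rank (x : X) := #|[set y | `[< r y x >]]%SET|.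

Lemma rank_lt x y : (rank x < rank y)%N <-> r x y.
Proof.
have rlt u v : r u v -> (rank u < rank v)%N.
  move=> uv; apply: proper_card; apply/fintype.properP; split.
    apply/fintype.subsetP => z; rewrite !inE => zu.
    exact: r_trans uv.
  by exists u; [rewrite !inE|apply/negP; rewrite !inE].
split=> [xy|/rlt//].
have [eqxy|//|/rlt] := r_total x y; first by rewrite eqxy ltnn in xy.
by rewrite ltnNge (ltnW xy).
Qed.

Lemma rank_inj : injective rank.
Proof.
by move=> x y xy; have [//||] := r_total x y => /rank_lt; rewrite xy ltnn.
Qed.

Lemma rank_ltn_card x : (rank x < #|X|)%N.
Proof.
rewrite -cardsT; apply: proper_card; rewrite properT.
by apply/eqP => /setP /(_ x); rewrite finset.in_set finset.in_setT => /asboolP/r_irr.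
Qed.

End rank.

Lemma rank_surj (X : finType) (r : X -> X -> Prop) :
  (forall x, ~ r x x) -> (forall x y z, r x y -> r y z -> r x z) ->
  (forall x y, [\/ x = y, r x y | r y x]) ->
  forall n, (n < #|X|)%N -> exists x, rank r x = n.
Proof.
move=> irr tr tot n nX.
pose f x := Ordinal (rank_ltn_card irr x).
have injf : injective f by move=> x y /(congr1 val) /(rank_inj irr tr tot).
have [|g _ fg] := inj_card_bij injf; first by rewrite card_ord.
by exists (g (Ordinal nX)); have /(congr1 val) := fg (Ordinal nX).
Qed.

Lemma card_tagged_fiber (I : finType) (T : I -> finType) (i : I) :
  #|[set u : {j : I & T j} | tag u == i]%SET| = #|T i|.
Proof.
rewrite -cardsT -(card_imset _ (f := fun j : T i => Tagged T j)).
  apply: eq_card => u; rewrite inE; apply/eqP/imsetP => [<-|[j _ ->//]].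
  by exists (tagged u) => //; case: u.
by move=> j k /eqP; rewrite eq_Tagged => /eqP.
Qed.

(* sigma matches, rank by rank, the bottom order of the cells with their top
   order. *)
Lemma discrete_iet_of_counts (Pi : grouped_permutation) (N : nat) (c : nat -> nat) :
  (forall g, exists a, [/\ (a < N)%N, (0 < c a)%N & group_of Pi a = g]) ->
  exists (X : finType) (key lab : X -> nat) (sigma : X -> X),
    discrete_iet Pi key lab sigma /\
    forall a, #|[set x | lab x == a]%SET| = if (a < N)%N then c a else 0.
Proof.
move=> cg; pose X := {i : 'I_N & 'I_(c i)} : finType.
pose lab (x : X) : nat := tag x; pose idx (x : X) : nat := tagged x.
have labidx x y : lab x = lab y -> idx x = idx y -> x = y.
  rewrite /lab /idx; case: x y => [i x] [j y] /= /val_inj ij; subst j.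
  by move=> /val_inj ->.
pose rk (left : nat -> nat -> Prop) (x y : X) :=
  left (lab x) (lab y) \/ (lab x = lab y /\ (idx x < idx y)%N).
have rk_irr left : (forall a, ~ left a a) -> forall x, ~ rk left x x.
  by move=> irr x [/irr//|[]]; rewrite ltnn.
have rk_tr left : (forall a b c, left a b -> left b c -> left a c) ->
    forall x y z, rk left x y -> rk left y z -> rk left x z.
  move=> tr x y z [xy|[xy lxy]] [yz|[yz lyz]].
  - by left; apply: tr yz.
  - by left; rewrite -yz.
  - by left; rewrite xy.
  - by right; split; [rewrite xy|apply: ltn_trans lyz].
have rk_tot left : (forall a b, [\/ a = b, left a b | left b a]) ->
    forall x y, [\/ x = y, rk left x y | rk left y x].
  move=> tot x y; have [xy|xy|xy] := tot (lab x) (lab y).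
  - have [lxy|lyx|/labidx->//] := ltngtP (idx x) (idx y).
    + by apply: Or32; right.
    + by apply: Or33; right.
    + exact: Or31.
  - by apply: Or32; left.
  - by apply: Or33; left.
pose rt := rk (left_top Pi); pose rb := rk (left_bot Pi).
have it := rk_irr _ (@left_top_irr Pi); have tt := rk_tr _ (@left_top_trans Pi).
have ttot := rk_tot _ (@left_top_total Pi).
have ib := rk_irr _ (@left_bot_irr Pi); have tb := rk_tr _ (@left_bot_trans Pi).
have btot := rk_tot _ (@left_bot_total Pi).
have /choice [sigma sigmaE] : forall x, exists y, rank rt y = rank rb x.
  by move=> x; apply: rank_surj => //; apply: rank_ltn_card.
exists X, (rank rt), lab, sigma; split.
  split.
  - exact: rank_inj.
  - move=> x y /(congr1 (rank rt)); rewrite !sigmaE; exact: rank_inj.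
  - by move=> x y /(rank_lt it tt ttot) [|[]]; [right|left].
  - by move=> x y; rewrite !sigmaE => /(rank_lt ib tb btot) [|[]]; [right|left].
  - move=> x y xy /(rank_lt it tt ttot) [|[_ lxy]].
      by rewrite xy => /left_top_irr.
    by rewrite !sigmaE; apply/(rank_lt ib tb btot); right.
  - move=> g; have [a [aN ca <-]] := cg g.
    by exists (Tagged (fun i : 'I_N => 'I_(c i)) (Ordinal ca : 'I_(c (Ordinal aN)))).
move=> a; case: ltnP => aN.
  rewrite -[RHS](card_ord (c a)).
  rewrite -(card_tagged_fiber (fun i : 'I_N => 'I_(c i)) (Ordinal aN)).
  by apply: eq_card => x; rewrite !inE.
apply/eqP; rewrite cards_eq0; apply/eqP/setP => x; rewrite !inE.
by apply/negbTE; rewrite neq_ltn (leq_trans (ltn_ord _) aN).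
Qed.

(** * Merging the orbits of a finite exchange *)

Lemma ltn_lexi N a b c d : (b <= N)%N -> (d <= N)%N ->
  (a * N.+1 + b < c * N.+1 + d)%N = (a < c)%N || (a == c) && (b < d)%N.
Proof.
move=> bN dN; apply/idP/orP => [lt|[ac|/andP[/eqP -> bd]]].
- have [ac|ca|ac] := ltngtP a c; [by left| |].
  have : (c.+1 * N.+1 <= a * N.+1)%N by rewrite leq_mul2r ca orbT.
  rewrite mulSn; lia.
- by right; rewrite ac ltn_add2l in lt.
- have : (a.+1 * N.+1 <= c * N.+1)%N by rewrite leq_mul2r ac orbT.
  rewrite mulSn; lia.
- by rewrite ltn_add2l.
Qed.

Definition left_neighbour (X : finType) (key : X -> nat) (y x : X) :=
  (key y < key x)%N && [forall z, (key z <= key y)%N || (key x <= key z)%N].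

Lemma left_neighbour_inj (X : finType) (key : X -> nat) (y y' x : X) :
  injective key -> left_neighbour key y x -> left_neighbour key y' x -> y = y'.
Proof.
move=> inj /andP[yx /forallP/(_ y') h] /andP[yx' /forallP/(_ y) h']; apply: inj.
move: h h'; rewrite [(key x <= _)%N]leqNgt yx' [(key x <= _)%N]leqNgt yx /= !orbF.
by move=> h h'; apply/eqP; rewrite eqn_leq h h'.
Qed.

Section merge.
Variables (Pi : grouped_permutation) (X : finType) (key lab : X -> nat).
Variables (sigma : X -> X).
Hypothesis D : discrete_iet Pi key lab sigma.

(* At time t the strand z leaves the cell sigma (z t) through its left end.  It
   is the last passage of z through that cell and the first one through the next
   cell, so that the jump does not alter the order of the passages. *)
Definition crossing (N : nat) (z : nat -> X) (t t1 : nat) :=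
  [/\ left_neighbour key (z t1) (sigma (z t)),
    forall u, (u < N)%N -> z u = sigma (z t) -> (u <= t)%N &
    forall u, (u < N)%N -> z u = z t1 -> (t1 <= u)%N].

Variables (S : {set X}) (n : nat) (z : nat -> X).
Hypothesis SS : forall x, (sigma x \in S) = (x \in S).
Hypothesis zS : forall t, (t < n.+1)%N -> z t \in S.
Hypothesis Sz : forall x, x \in S -> exists2 t, (t < n.+1)%N & z t = x.
Hypothesis z_step : forall t, (t.+1 < n.+1)%N ->
  z t.+1 = sigma (z t) \/ crossing n.+1 z t t.+1.
Hypothesis z_wrap : left_neighbour key (z 0) (sigma (z n)).

(** The cells of [S] are replaced by the passages of the strand [z]: a cell is split into as many
    cells as it has passages. *)
Definition merged_cell : finType := ({x : X | x \notin S} + 'I_n.+1)%type.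
Implicit Types a b : merged_cell.

Definition merged_base a : X :=
  match a with inl x => val x | inr t => z t end.

(** Inside a cell, later passages lie further to the left. Hence a first passage is the rightmost
    one of its cell, and a strand arriving after the last passage would be the leftmost one. *)
Definition merged_height a : nat :=
  match a with inl _ => 0 | inr t => (n.+1 - t)%N end.

Definition merged_key a := (key (merged_base a) * n.+2 + merged_height a)%N.

Definition merged_lab a := lab (merged_base a).

Definition next_strand (t : 'I_n.+1) : 'I_n.+1 :=
  if (t < n)%N then inord t.+1 else ord0.

Definition merged_sigma a : merged_cell :=
  match a with
  | inl x => inl (insubd x (sigma (val x)))
  | inr t => inr (next_strand t)
  end.

(* The key that merged_sigma a would have if all strands were to follow sigma;
   at the crossings this is not the key of a merged cell, but it is adjacent to
   the actual one. *)
Let virtual_height a : nat := match a with inl _ => 0 | inr t => (n - t)%N end.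

Let virtual_key a :=
  (key (sigma (merged_base a)) * n.+2 + virtual_height a)%N.

Let height_le a : (merged_height a <= n.+1)%N.
Proof. by case: a => [//|t]; rewrite leq_subr. Qed.

Let virtual_height_le a : (virtual_height a <= n.+1)%N.
Proof. by case: a => [//|t] /=; rewrite (leq_trans (leq_subr _ _)). Qed.

Let baseS a : (merged_base a \in S) = if a is inr _ then true else false.
Proof. by case: a => [[x xS]|t] /=; [apply/negbTE|apply: zS]. Qed.

Lemma val_merged_sigma_inl (x : {x : X | x \notin S}) :
  val (insubd x (sigma (val x))) = sigma (val x).
Proof. by rewrite insubdK//; case: x => x xS; rewrite unfold_in /= SS. Qed.

Let next_strand_inj : injective next_strand.
Proof.
move=> t u; rewrite /next_strand.
have tn := ltn_ord t; have un := ltn_ord u.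
case: ltnP => tn'; case: ltnP => un' /(congr1 val) /=; rewrite ?inordK//.
- by move=> [] /val_inj.
- by move=> _; apply/val_inj => /=; lia.
Qed.

Let merged_sigma_inj : injective merged_sigma.
Proof.
case=> [x|t] [y|u] //= [].
  move=> /(congr1 val); rewrite !val_merged_sigma_inl => /(sigma_inj D).
  by move=> /val_inj ->.
by move=> /next_strand_inj ->.
Qed.

Let merged_key_inj : injective merged_key.
Proof.
move=> a b ab; have : merged_base a = merged_base b /\ merged_height a = merged_height b.
  have := ltnn (merged_key a); rewrite {2}ab ltn_lexi ?height_le//.
  have := ltnn (merged_key a); rewrite {1}ab ltn_lexi ?height_le//.
  case: ltngtP => //= /(key_inj D) eq_base; split=> //; lia.
case: a b {ab} => [x|t] [y|u] //= [].
- by move=> /val_inj ->.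
- by move=> _; have := ltn_ord u; lia.
- by move=> _; have := ltn_ord t; lia.
- move=> _ tu; congr inr; apply/val_inj => /=.
  by have := ltn_ord u; have := ltn_ord t; lia.
Qed.

Let virtual_key_inj : injective virtual_key.
Proof.
move=> a b ab; have : merged_base a = merged_base b /\ virtual_height a = virtual_height b.
  have := ltnn (virtual_key a); rewrite {2}ab ltn_lexi ?virtual_height_le//.
  have := ltnn (virtual_key a); rewrite {1}ab ltn_lexi ?virtual_height_le//.
  by case: ltngtP => //= /(key_inj D) /(sigma_inj D) eq_base; split=> //; lia.
move=> [ab1]; have := congr1 (fun x => x \in S) ab1; rewrite /= !baseS.
case: a b {ab} ab1 => [x|t] [y|u] //=.
- by move=> /val_inj ->.
- move=> _ _ tu; congr inr; apply/val_inj => /=.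
  by have := ltn_ord u; have := ltn_ord t; lia.
Qed.

Let merged_sigma_cases a :
  (merged_base (merged_sigma a) = sigma (merged_base a) /\
   merged_height (merged_sigma a) = virtual_height a) \/
  (exists t t1 : 'I_n.+1, [/\ a = inr t, merged_sigma a = inr t1 &
     crossing n.+1 z t t1]).
Proof.
case: a => [x|t]; first by left; rewrite /= val_merged_sigma_inl.
have [tn|nt] := ltnP t n; last first.
  (* Closing the strand: time [n] is last and time 0 is first among all passages, so [z_wrap] is all
     that a crossing requires. *)
  right; exists t, ord0; rewrite /= /next_strand ltnNge nt/=; split=> //.
  have -> : t = n :> nat by have := ltn_ord t; lia.
  by split=> // u; lia.
have next_t : next_strand t = t.+1 :> nat by rewrite /next_strand tn inordK.
have [|z_cross] := @z_step t tn.
  by left; rewrite /= next_t; split=> //; lia.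
by right; exists t, (next_strand t); rewrite /= next_t.
Qed.

Let base_inr a t : merged_base a = z t -> (t < n.+1)%N ->
  exists2 u : 'I_n.+1, a = inr u & z u = z t.
Proof.
case: a => [[x xS]|u] /= az tn; last by exists u.
by exfalso; move: (xS); rewrite az (zS tn).
Qed.

(** At a crossing, the virtual slot is below all passages through [sigma (z t)], whose times are at
    most [t], and the actual slot is above all other passages through the left neighbour, whose
    times are at least [t1]. No other cell lies between the two slots, so exchanging them keeps the
    order. *)
Let virtual_key_mono a b : (virtual_key a < virtual_key b)%N ->
  (merged_key (merged_sigma a) < merged_key (merged_sigma b))%N.
Proof.
move=> ab; have neq_ab : merged_sigma a <> merged_sigma b.
  by move=> /merged_sigma_inj eq_ab; rewrite eq_ab ltnn in ab.
have leS x y : key (sigma x) = key (sigma y) -> x = y.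
  by move=> /(key_inj D)/(sigma_inj D).
have [[ac ah]|[t [t1 [at_ at1 [/andP[nb nbF] last first_]]]]] := merged_sigma_cases a;
have [[bc bh]|[u [u1 [bu bu1 [/andP[nb' nbF'] last' first']]]]] := merged_sigma_cases b.
- by rewrite /merged_key ac ah bc bh.
- move: ab; rewrite /virtual_key -ac -ah /merged_key bu1 bu.
  rewrite !ltn_lexi//=; [|exact: leq_subr|exact: (leq_trans (leq_subr _ _))].
  move=> /orP[lt|/andP[/eqP/(key_inj D) eq_base lt]].
    have := forallP nbF' (merged_base (merged_sigma a)).
    rewrite [X in _ || X]leqNgt lt orbF leq_eqVlt => /orP[/eqP/(key_inj D) eqb|->//].
    have [v av zv] := base_inr eqb (ltn_ord _).
    rewrite eqb ltnn eqxx /= av /=.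
    have u1v := first' v (ltn_ord _) zv.
    have : u1 != v :> nat.
      by apply/eqP => /val_inj uv; apply: neq_ab; rewrite av bu1 uv.
    have := ltn_ord v; lia.
  have eq_S : sigma (z u) \in S by rewrite SS zS.
  move: lt; case E : (merged_sigma a) eq_base => [[x xS]|v] /= eq_base lt.
    by exfalso; move: (xS); rewrite eq_base eq_S.
  by have := last' v (ltn_ord _) eq_base; lia.
- move: ab; rewrite /virtual_key -bc -bh /merged_key at1 at_.
  rewrite !ltn_lexi//=; [|exact: leq_subr|exact: (leq_trans (leq_subr _ _))].
  by move=> /orP[lt|/andP[/eqP eqb _]]; rewrite ?(ltn_trans nb lt)// -eqb nb.
- move: ab; rewrite /virtual_key /merged_key at1 at_ bu1 bu.
  rewrite !ltn_lexi//=; [|exact: leq_subr|exact: leq_subr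
    |exact: (leq_trans (leq_subr _ _))|exact: (leq_trans (leq_subr _ _))].
  move=> /orP[lt|/andP[/eqP/(key_inj D) eqb _]].
    have := forallP nbF' (sigma (z t)); rewrite [X in _ || X]leqNgt lt orbF => le.
    by rewrite (leq_trans nb le).
  (* Two crossings into the same cell are both its first passage, hence coincide. *)
  have eqz : z t1 = z u1.
    apply: (left_neighbour_inj (x := sigma (z t)) (key_inj D)).
      by rewrite /left_neighbour nb.
    by rewrite eqb /left_neighbour nb'.
  case: neq_ab; rewrite at1 bu1; congr inr; apply/val_inj/eqP => /=.
  by rewrite eqn_leq first_ ?first'.
Qed.

Lemma merged_iet : discrete_iet Pi merged_key merged_lab merged_sigma.
Proof.
split=> //.
- move=> a b; rewrite ltn_lexi// => /orP[/(key_top D)//|/andP[/eqP]].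
  by move=> /(key_inj D) ab _; left; rewrite /merged_lab ab.
- move=> a b ab; have : (virtual_key a < virtual_key b)%N.
    have [//|/virtual_key_mono ba|/virtual_key_inj eqab] :=
      ltngtP (virtual_key a) (virtual_key b).
      by rewrite ltnNge (ltnW ba) in ab.
    by rewrite eqab ltnn in ab.
  rewrite ltn_lexi// => /orP[/(key_bot D)//|/andP[/eqP]].
  by move=> /(key_inj D)/(sigma_inj D) eqab _; left; rewrite /merged_lab eqab.
- move=> a b lab_ab; rewrite ltn_lexi// => lt; apply: virtual_key_mono.
  rewrite ltn_lexi//; move: lt => /orP[/(key_lab D lab_ab) -> //|/andP[/eqP]].
  move=> /(key_inj D) eqab lt; rewrite eqab eqxx ltnn /=.
  have := congr1 (fun x => x \in S) eqab; rewrite /= !baseS.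
  case: a b {lab_ab} lt eqab => [x|t] [y|u] //= lt _ _.
  by have := ltn_ord u; have := ltn_ord t; lia.
- move=> g; have [x <-] := lab_group D g.
  have [/Sz [t tn zt]|xS] := boolP (x \in S).
    by exists (inr (Ordinal tn)); rewrite /merged_lab /= zt.
  by exists (inl (exist _ x xS)).
Qed.

Lemma iter_merged_sigma k : (k <= n)%N ->
  iter k merged_sigma (inr ord0) = inr (inord k).
Proof.
elim: k => [|k IHk] kn; first by congr inr; apply/val_inj; rewrite /= inordK.
by rewrite iterS IHk 1?ltnW//= /next_strand inordK ?kn// ltnS ltnW.
Qed.

End merge.

(** * Strands winding around the orbits of a path *)

Section strand.
Variables (X : finType) (key : X -> nat) (sigma : X -> X).
Hypothesis sigma_inj : injective sigma.

Local Notation orbit_of := (froot sigma).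

Definition strand_step (s : seq X) := forall x0 t, (t.+1 < size s)%N ->
  nth x0 s t.+1 = sigma (nth x0 s t) \/
  crossing key sigma (size s) (nth x0 s) t t.+1.

Lemma froot_sigma x : orbit_of (sigma x) = orbit_of x.
Proof.
apply/eqP; rewrite eq_sym root_connect; first exact: fconnect1.
exact: fconnect_sym.
Qed.

Lemma froot_iter k x : orbit_of (iter k sigma x) = orbit_of x.
Proof. by elim: k => //= k <-; rewrite froot_sigma. Qed.

Lemma froot_fconnect x y : orbit_of x = orbit_of y -> fconnect sigma x y.
Proof. by move=> /eqP; rewrite root_connect//; exact: fconnect_sym. Qed.

Lemma strand_step_traject y L : strand_step (traject sigma y L).
Proof.
move=> x0 t; rewrite size_traject => tL; left; have tL' := ltnW tL.
by rewrite !(set_nth_default y x0) ?size_traject// !nth_traject.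
Qed.

(** The pieces run in different orbits, so neither meets a cell of the other: first and last
    passages are unchanged, and the junction is a crossing as soon as it goes to a left
    neighbour. *)
Lemma strand_step_cat x1 s1 x2 s2 :
  (forall x y, x \in x1 :: s1 -> y \in x2 :: s2 -> orbit_of x <> orbit_of y) ->
  strand_step (x1 :: s1) -> strand_step (x2 :: s2) ->
  left_neighbour key x2 (sigma (last x1 s1)) ->
  strand_step ((x1 :: s1) ++ x2 :: s2).
Proof.
move=> disj st1 st2 nb x0 t; rewrite size_cat => tlt.
set s := _ ++ _; set n1 := size (x1 :: s1) in tlt *.
set n2 := size (x2 :: s2) in tlt *.
have nth1 u : (u < n1)%N -> nth x0 s u = nth x0 (x1 :: s1) u.
  by move=> un; rewrite nth_cat un.
have nth2 u : nth x0 s (n1 + u) = nth x0 (x2 :: s2) u.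
  by rewrite nth_cat ltnNge leq_addr/= addKn.
have in1 u : (u < n1)%N -> nth x0 s u \in x1 :: s1.
  by move=> un; rewrite nth1// mem_nth.
have in2 u : (n1 <= u)%N -> (u < n1 + n2)%N -> nth x0 s u \in x2 :: s2.
  by move=> nu ul; rewrite -(subnKC nu) nth2 mem_nth//; rewrite -/n2; lia.
have [t1n|nt1] := ltnP t.+1 n1.
  have tn := ltnW t1n; have := st1 x0 t t1n; rewrite /crossing -!nth1//.
  move=> [->|[nbt last1 first1]]; first by left.
  right; split=> // u ul eu; have [un|nu] := ltnP u n1.
  - by apply: last1 => //; rewrite -nth1.
  - have := disj _ _ (in1 _ (ltnW t1n)) (in2 _ nu ul).
    by rewrite eu froot_sigma.
  - by apply: first1 => //; rewrite -nth1.
  - by rewrite (leq_trans (ltnW t1n)).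
have [tn|nt] := ltnP t n1.
  have tE : t.+1 = n1 by lia.
  have nt_last : nth x0 s t = last x1 s1.
    by rewrite nth1// (last_nth x0) -/n1; have -> : t = size s1 by move: tE => [].
  have nt1_head : nth x0 s t.+1 = x2 by rewrite tE -[n1]addn0 nth2.
  right; split.
  - by rewrite nt_last nt1_head.
  - move=> u ul eu; rewrite leqNgt; apply/negP => tu.
    have := disj _ _ (in1 _ tn) (in2 u _ ul); rewrite -tE eu froot_sigma.
    by move=> /(_ tu); apply.
  - move=> u ul eu; rewrite tE leqNgt; apply/negP => un.
    by have := disj _ _ (in1 _ un) (in2 t.+1 nt1 tlt); rewrite eu; apply.
pose t' := (t - n1)%N; have tE : t = (n1 + t')%N by rewrite subnKC.
rewrite tE -addnS !nth2; have t'l : (t'.+1 < n2)%N by lia.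
have [->|[nbt last2 first2]] := st2 x0 t' t'l; first by left.
right; split; rewrite !nth2//.
- move=> u ul eu; have [un|nu] := ltnP u n1; first by lia.
  rewrite -(subnKC nu) leq_add2l; apply: last2; first by rewrite -/n2; lia.
  by rewrite -nth2 subnKC.
- move=> u ul eu; have [un|nu] := ltnP u n1.
    have := disj _ _ (in1 _ un) (in2 (n1 + t'.+1)%N (leq_addr _ _) _).
    rewrite nth2 eu => H; case: H => //; lia.
  rewrite -(subnKC nu) leq_add2l; apply: first2; first by rewrite -/n2; lia.
  by rewrite -nth2 subnKC.
Qed.

(** A full turn meets each cell of the orbit once, and the [d] remaining steps repeat none. *)
Lemma count_traject y x r d : fconnect sigma y x -> (d <= order sigma y)%N ->
  (r <= count_mem x (traject sigma y (r * order sigma y + d)) <= r.+1)%N.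
Proof.
move=> yx dy; elim: r => [|r IHr].
  rewrite mul0n add0n leq0n /=.
  have : uniq (traject sigma y d).
    by rewrite -(take_traject _ _ dy) take_uniq// orbit_uniq.
  by move=> /count_uniq_mem ->; case: (_ \in _).
rewrite mulSn -addnA trajectD iter_order// count_cat.
have -> : count_mem x (traject sigma y (order sigma y)) = 1%N.
  by rewrite count_uniq_mem ?orbit_uniq// -/(orbit sigma y) -fconnect_orbit yx.
by rewrite add1n !ltnS.
Qed.

Variables (R : realType) (K : R) (w : X -> R).
Hypothesis w_sigma : forall x, w (sigma x) = w x.
Local Open Scope ring_scope.
Hypothesis Kw : forall x, 1 <= K * w x.

Definition orbit_edge (a b : X) := [exists x, exists y,
  [&& orbit_of x == a, orbit_of y == b & left_neighbour key y x]].

Lemma w_iter k x : w (iter k sigma x) = w x.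
Proof. by elim: k => //= k <-; rewrite w_sigma. Qed.

(** The segment makes [truncn (K * w y)] full turns and then goes on until the next cell would be
    [x]. The weight [K^-1] per passage then reproduces [w] up to [K^-1]. *)
Lemma strand_segment y x : orbit_of y = orbit_of x ->
  exists s, [/\ strand_step (y :: s), sigma (last y s) = x,
    forall z, z \in y :: s -> orbit_of z = orbit_of y &
    forall z, orbit_of z = orbit_of y -> (0 < count_mem z (y :: s))%N /\
      `|(count_mem z (y :: s))%:R - K * w z| <= 1].
Proof.
move=> /froot_fconnect yx.
pose r := Num.truncn (K * w y); pose L := (r * order sigma y + findex sigma y x)%N.
have r1 : (1 <= r)%N by rewrite truncn_ge_nat// (le_trans _ (Kw y)).
have rE : (r%:R : R) <= K * w y < r.+1%:R.
  by apply: truncn_itv; rewrite (le_trans _ (Kw y)).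
(* By [Kw] there is at least one full turn: the segment is nonempty even when [x = y]. *)
have L0 : (0 < L)%N by rewrite addn_gt0 muln_gt0 r1 order_gt0.
exists (traject sigma (sigma y) L.-1).
rewrite -trajectS prednK//; split.
- exact: strand_step_traject.
- rewrite last_traject -iterS prednK// /L addnC iterD.
  suff -> : iter (r * order sigma y) sigma y = y by rewrite iter_findex.
  by elim: (r) => // q IHq; rewrite mulSn iterD IHq iter_order.
- by move=> z /trajectP [i _ ->]; rewrite froot_iter.
- move=> z zy; have {zy}yz : fconnect sigma y z by apply: froot_fconnect.
  have wz : w z = w y by rewrite -(iter_findex yz) w_iter.
  have /andP[c1 c2] := count_traject r yz (ltnW (findex_max yx)).
  split; first exact: leq_trans c1.
  move: c1 c2 rE; rewrite wz -/L -!(ler_nat R) -!natr1 => c1 c2 /andP[r1' r2'].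
  by rewrite ler_norml; apply/andP; split; lra.
Qed.

(** One segment per orbit of the path, glued along the edges; the path being simple, the orbits are
    disjoint as gluing demands. *)
Lemma strand_path a p y x : path orbit_edge a p -> uniq (a :: p) ->
  orbit_of y = a -> orbit_of x = last a p ->
  exists s, [/\ strand_step (y :: s), sigma (last y s) = x,
    forall z, z \in y :: s -> orbit_of z \in a :: p &
    forall z, orbit_of z \in a :: p -> (0 < count_mem z (y :: s))%N /\
      `|(count_mem z (y :: s))%:R - K * w z| <= 1].
Proof.
elim: p a y => [|b p IHp] a y /=.
  move=> _ _ ya xa; have [|s [st sl sa sc]] := @strand_segment y x.
    by rewrite ya xa.
  exists s; split=> //; first by move=> z /sa ->; rewrite ya inE.
  by move=> z; rewrite inE -ya => /eqP/sc.
move=> /andP[/existsP[u /existsP[v /and3P[/eqP ua /eqP vb nb]]] pbp].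
move=> /andP[abp ubp] ya xl.
have [s2 [st2 sl2 sa2 sc2]] := IHp b v pbp ubp vb xl.
have [|s1 [st1 sl1 sa1 sc1]] := @strand_segment y u; first by rewrite ya ua.
exists (s1 ++ v :: s2); rewrite -cat_cons.
have disj z z' : z \in y :: s1 -> z' \in v :: s2 -> orbit_of z <> orbit_of z'.
  move=> /sa1 -> /sa2 z'b zz'; move: abp; rewrite -ya zz' z'b//.
split.
- by apply: strand_step_cat => //; rewrite sl1.
- by rewrite last_cat.
- move=> z; rewrite mem_cat => /orP[/sa1 ->|/sa2 zb]; first by rewrite ya inE eqxx.
  by rewrite inE zb orbT.
- move=> z; rewrite inE count_cat addnA -/(count_mem z (y :: s1)).
  move=> /orP[/eqP za|zb].
    have -> : count_mem z (v :: s2) = 0%N.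
      apply/count_memPn; apply/negP => /sa2.
      by rewrite za (negbTE abp).
    by rewrite addn0; apply: sc1; rewrite za ya.
  have -> : count_mem z (y :: s1) = 0%N.
    apply/count_memPn; apply/negP => /sa1 zy.
    by move: abp; rewrite -ya -zy zb.
  by rewrite add0n; apply: sc2.
Qed.

End strand.

Local Open Scope ring_scope.

Lemma left_neighbour_ex (X : finType) (key : X -> nat) x y :
  (key x < key y)%N ->
  exists2 u, left_neighbour key u y & (key x <= key u)%N.
Proof.
move=> xy; case: (@arg_maxnP X x (fun u => (key u < key y)%N) key xy) => u uy umax.
exists u; last exact: umax.
apply/andP; split=> //; apply/forallP => z.
by have [/umax zu|yz] := ltnP (key z) (key y); apply/orP; [left|right].
Qed.

(** The cells with a reachable orbit form an invariant set that is closed under left neighbours,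
    hence an initial segment. *)
Lemma orbit_connect (Pi : grouped_permutation) (X : finType) (key lab : X -> nat)
    (sigma : X -> X) :
  is_irreducible Pi -> discrete_iet Pi key lab sigma ->
  forall x y, connect (orbit_edge key sigma) (froot sigma x) (froot sigma y).
Proof.
move=> irr D x y.
pose M := [set z | connect (orbit_edge key sigma) (froot sigma x) (froot sigma z)]%SET.
suff : y \in M by rewrite inE.
apply: (invariant_initial_segment irr D (x0 := x)).
- by rewrite inE.
- move=> u v; have [n] := ubnP (key v); elim: n v => // n IHn v vn vM uv.
  have [t tv ut] := left_neighbour_ex uv.
  have tM : t \in M.
    move: vM; rewrite !inE => /connect_trans; apply; apply: connect1.
    by apply/existsP; exists v; apply/existsP; exists t; rewrite !eqxx.
  move: ut; rewrite leq_eqVlt => /orP[/eqP/(key_inj D) -> //|]; apply: IHn => //.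
  by move: tv => /andP[tv _]; lia.
- by move=> u; rewrite !inE froot_sigma//; exact: sigma_inj D.
Qed.

Definition mass (R : realType) (X : finType) (lab : X -> nat) (w : X -> R) (a : nat) : R :=
  \sum_(x | lab x == a) w x.

Lemma sum_fiber_le (R : realType) (T : finType) (f : T -> nat) (v : T -> R) (N : nat) :
  (forall y, 0 <= v y) -> \sum_(a < N) \sum_(y | f y == a) v y <= \sum_y v y.
Proof.
move=> v0; rewrite (exchange_big_dep xpredT)//=; apply: ler_sum => y _.
case: (ltnP (f y) N) => yN.
  rewrite (bigD1 (Ordinal yN))//= big1 ?addr0// => i /andP[/eqP yi].
  by case/eqP; apply/val_inj; rewrite /= yi.
rewrite big_pred0// => i.
by apply/negbTE; rewrite neq_ltn (leq_trans (ltn_ord i) yN) orbT.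
Qed.

(** Replacing a cell of [X] by its fibre costs at most [d], whichever letter it belongs to; hence a
    bound independent of [N]. *)
Lemma mass_fiber (R : realType) (X Y : finType) (lab : X -> nat) (f : Y -> X)
    (w : X -> R) (v : Y -> R) (d : R) (N : nat) :
  (forall x, `|w x - \sum_(y | f y == x) v y| <= d) ->
  \sum_(a < N) `|mass lab w a - mass (lab \o f) v a| <= d *+ #|X|.
Proof.
move=> wv; pose u x := `|w x - \sum_(y | f y == x) v y|.
have massE a : mass (lab \o f) v a = \sum_(x | lab x == a) \sum_(y | f y == x) v y.
  rewrite /mass (partition_big f (fun x => lab x == a))//=.
  apply: eq_bigr => x /eqP xa; apply: eq_bigl => y /=.
  by case: (f y =P x) => [->|]; rewrite ?xa ?eqxx// andbF.
apply: (@le_trans _ _ (\sum_(a < N) \sum_(x | lab x == a) u x)).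
  apply: ler_sum => a _; rewrite massE -sumrB; exact: ler_norm_sum.
apply: (@le_trans _ _ (\sum_x u x)).
  by apply: sum_fiber_le => x; exact: normr_ge0.
by apply: le_trans (ler_sum _ (fun x _ => wv x)) _; rewrite sumr_const.
Qed.

(** * Reduction to a single orbit *)

Section merge_orbits.
Variables (R : realType) (Pi : grouped_permutation) (Pi_irr : is_irreducible Pi).

(** The length of the list of representatives is the measure of the induction: the orbits on a
    cycle, at least two, give way to the single orbit of the strand. *)
Lemma merge_orbits (X : finType) (key lab : X -> nat) (sigma : X -> X)
    (w : X -> R) (reps : seq X) (e : R) :
  discrete_iet Pi key lab sigma -> (forall x, w (sigma x) = w x) ->
  (forall x, 0 < w x) ->
  (forall x, exists2 r, r \in reps & fconnect sigma r x) ->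
  0 < e -> (exists x y, ~~ fconnect sigma x y) ->
  exists (Y : finType) (key' lab' : Y -> nat) (sigma' : Y -> Y) (w' : Y -> R)
    (reps' : seq Y),
    [/\ [/\ discrete_iet Pi key' lab' sigma', forall x, w' (sigma' x) = w' x &
         forall x, 0 < w' x],
      forall x, exists2 r, r \in reps' & fconnect sigma' r x,
      (size reps' < size reps)%N, (#|X| <= #|Y|)%N &
      forall N, \sum_(a < N) `|mass lab w a - mass lab' w' a| <= e].
Proof.
move=> D ws w0 cover e0 [x1 [x2 x12]].
have sI := sigma_inj D; have fsym := fconnect_sym sI.
have conn := orbit_connect Pi_irr D.
pose a := froot sigma x1.
(* An edge leaving the orbit of [x1]; a simple path from [c] back to [a] completes it to a cycle. *)
have [c ac [xe [ye [xea yec nb]]]] : exists2 c, a != c &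
    exists x y, [/\ froot sigma x = a, froot sigma y = c & left_neighbour key y x].
  have /connectP [p0 pp0 lp0] := conn x1 x2.
  case/shortenP : pp0 lp0 => -[|c p] pp up _ lp.
    by move: x12; rewrite -(root_connect fsym) eq_sym /= in lp *; rewrite lp eqxx.
  move: pp => /= /andP[/existsP[x /existsP[y /and3P[/eqP xa /eqP yc nb]]] _].
  exists c; last by exists x, y.
  by move: up => /= /andP[]; rewrite inE negb_or => /andP[].
have /connectP [p0 pp0 lp0] := conn ye xe.
rewrite yec xea in pp0 lp0.
case/shortenP : pp0 lp0 => p pp up _ lp.
(* The first term ensures [1 <= K * w x], the second [#|X| / K <= e]. *)
pose K : R := \sum_x (w x)^-1 + #|X|%:R / e.
have X0 : (0 < #|X|)%N by apply/card_gt0P; exists x1.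
have wV x : 0 <= (w x)^-1 by rewrite invr_ge0 ltW.
have Xe0 : 0 < #|X|%:R / e by rewrite divr_gt0// ltr0n.
have K0 : 0 < K by rewrite ltr_wpDl// sumr_ge0.
have Kw x : 1 <= K * w x.
  rewrite -ler_pdivrMr// mul1r /K (bigD1 x)//= -addrA lerDl.
  by rewrite addr_ge0 ?sumr_ge0// ltW.
have [|s [st sl sa sc]] := strand_path sI ws Kw pp up yec (x := xe).
  by rewrite xea.
pose S := [set x | froot sigma x \in c :: p]%SET.
pose n := size s; pose z := nth ye (ye :: s).
have SS x : (sigma x \in S) = (x \in S) by rewrite !inE froot_sigma.
have zS t : (t < n.+1)%N -> z t \in S.
  by move=> tn; rewrite inE; apply: sa; apply: mem_nth.
have Sz x : x \in S -> exists2 t, (t < n.+1)%N & z t = x.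
  rewrite inE => /sc [+ _]; rewrite -has_count has_pred1 => xs.
  exists (index x (ye :: s)); last exact: nth_index.
  by rewrite -index_mem in xs.
(* The strand stops when its next cell would be [xe], and steps over to its start [ye] along the
   edge from [a] to [c]. *)
have z_wrap : left_neighbour key (z 0%N) (sigma (z n)).
  by rewrite /z /n (nth_last ye (ye :: s)) /= sl.
have D' := merged_iet D SS zS Sz (st ye) z_wrap.
pose Y := merged_cell S n.
pose sigma' := @merged_sigma X sigma S n.
pose w' (y : Y) : R := if y is inl x then w (val x) else K^-1.
pose reps' : seq Y := inr ord0 :: [seq inl x | x <- pmap insub reps].
exists Y, (merged_key key z), (merged_lab lab z), sigma', w', reps'.
have iter_inl k (x : {x : X | x \notin S}) : exists2 u : {x : X | x \notin S},
    iter k sigma' (inl x) = inl u & val u = iter k sigma (val x).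
  elim: k => [|k [u ku uk]]; first by exists x.
  exists (insubd u (sigma (val u))); first by rewrite iterS ku.
  by rewrite iterS val_merged_sigma_inl// uk.
split.
- split=> //.
  + by case=> [x|t] //=; rewrite val_merged_sigma_inl.
  + by case=> [x|t] //=; rewrite invr_gt0.
- case=> [x|t].
    have [r rreps rx] := cover (val x).
    have rS : r \notin S.
      apply: contra (valP x); rewrite !inE.
      by move: rx; rewrite -(root_connect fsym) => /eqP ->.
    exists (inl (exist _ r rS)).
      rewrite inE; apply/orP; right; apply/mapP; exists (exist _ r rS) => //.
      by rewrite mem_pmap_sub.
    have [u uk uE] := iter_inl (findex sigma r (val x)) (exist _ r rS).
    have <- : u = x by apply/val_inj; rewrite uE /= iter_findex.
    by rewrite -uk fconnect_iter.
  exists (inr ord0); first by rewrite inE eqxx.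
  have <- : iter t sigma' (inr ord0) = inr t.
    by rewrite iter_merged_sigma ?inord_val// -ltnS ltn_ord.
  exact: fconnect_iter.
- rewrite /= size_map size_pmap_sub -[size reps](count_predC (mem S)).
  have -> : count [pred x | x \notin S] reps = count (predC (mem S)) reps by [].
  rewrite -[X in (X < _)%N]add1n ltn_add2r -size_filter.
  (* At least two representatives are dropped, those of the orbits [a] and [c], for the single new
     one [inr ord0]. *)
  have [ra rar ara] := cover xe; have [rc rcr crc] := cover ye.
  have ra_a : froot sigma ra = a.
    by move: ara; rewrite -(root_connect fsym) => /eqP ->.
  have rc_c : froot sigma rc = c.
    by move: crc; rewrite -(root_connect fsym) => /eqP ->.
  apply: (@uniq_leq_size _ [:: ra; rc]).
    rewrite /= inE andbT; apply/eqP => rac.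
    by move: ac; rewrite -ra_a -rc_c rac eqxx.
  move=> x; rewrite !inE mem_filter => /orP[]/eqP ->.
    by rewrite rar andbT /= inE ra_a lp mem_last.
  by rewrite rcr andbT /= inE rc_c mem_head.
- have /choice [f fK] : forall x, exists y : Y, merged_base z y = x.
    move=> x; have [/Sz [t tn zt]|xS] := boolP (x \in S).
      by exists (inr (Ordinal tn)).
    by exists (inl (exist _ x xS)).
  by apply: (@leq_card _ _ f) => x y xy; rewrite -[x]fK xy fK.
- move=> N; have -> : merged_lab lab z = lab \o (merged_base z : Y -> X) by [].
  apply: (@le_trans _ _ (K^-1 *+ #|X|)); last first.
    rewrite -mulr_natl ler_pdivrMr// mulrC -ler_pdivrMr// /K.
    by rewrite lerDr sumr_ge0.
  apply: mass_fiber => x; rewrite big_sumType /=.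
  have [xS|xS] := boolP (x \in S).
    rewrite big_pred0 ?add0r; last first.
      by case=> u uS /=; apply: contraNF uS => /eqP ->.
    have -> : \sum_(i < n.+1 | z i == x) K^-1 = K^-1 * (count_mem x (ye :: s))%:R.
      rewrite mulr_natr -[RHS]addr0 -iter_addr -big_const_seq.
      by rewrite [RHS](big_nth ye) big_mkord.
    have xcp : froot sigma x \in c :: p by move: xS; rewrite inE.
    have [_ cx] := sc x xcp.
    rewrite -[w x](mulKf (lt0r_neq0 K0)) -mulrBr normrM gtr0_norm ?invr_gt0//.
    by rewrite distrC -[leRHS]mulr1 ler_pM2l ?invr_gt0.
  rewrite [X in _ - (_ + X)]big_pred0 ?addr0; last first.
    by move=> i; apply: contraNF xS => /eqP <-; apply: zS.
  rewrite (big_pred1 (exist _ x xS)).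
    by rewrite subrr normr0 invr_ge0 ltW.
  by move=> u; rewrite /= -val_eqE.
Qed.

Lemma single_orbit_approx k (X : finType) (key lab : X -> nat) (sigma : X -> X)
    (w : X -> R) (reps : seq X) (e : R) :
  discrete_iet Pi key lab sigma -> (forall x, w (sigma x) = w x) ->
  (forall x, 0 < w x) ->
  (forall x, exists2 r, r \in reps & fconnect sigma r x) ->
  (size reps <= k)%N -> 0 < e ->
  exists (Y : finType) (key' lab' : Y -> nat) (sigma' : Y -> Y) (omega : R),
    [/\ discrete_iet Pi key' lab' sigma', 0 < omega,
      forall x y, fconnect sigma' x y, (#|X| <= #|Y|)%N &
      forall N, \sum_(a < N) `|mass lab w a - mass lab' (fun=> omega) a| <= e].
Proof.
elim: k X key lab sigma w reps e =>
  [|k IHk] X key lab sigma w reps e D ws w0 cover rk e0.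
  have g : groups Pi.
    by have := card_groups_ge2 Pi; case: (pickP (groups Pi)) => [g|/eq_card0 ->].
  have [x _] := lab_group D g; have [r rreps _] := cover x.
  by move: rk; rewrite leqn0 size_eq0 => /eqP reps0; rewrite reps0 in rreps.
have [[x [y xy]]|allconn] := pselect (exists x y, ~~ fconnect sigma x y); last first.
  have g : groups Pi.
    by have := card_groups_ge2 Pi; case: (pickP (groups Pi)) => [g|/eq_card0 ->].
  have [x _] := lab_group D g.
  have con u v : fconnect sigma u v.
    by apply: contrapT => /negP uv; apply: allconn; exists u, v.
  exists X, key, lab, sigma, (w x); split=> // N.
  rewrite big1 ?ltW// => a _; apply/eqP; rewrite normr_eq0 subr_eq0; apply/eqP.
  apply: eq_bigr => y _; rewrite -(iter_findex (con x y)).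
  by elim: (findex _ _ _) => //= i <-; rewrite ws.
have [||Y [key' [lab' [sigma' [w' [reps' [[D' ws' w0'] cover' rr' XY dist]]]]]]] :=
  @merge_orbits X key lab sigma w reps (e / 2) D ws w0 cover.
- by rewrite divr_gt0.
- by exists x, y.
have [||Z [key2 [lab2 [sigma2 [om [D2 om0 con2 YZ dist2]]]]]] :=
  IHk Y key' lab' sigma' w' reps' (e / 2) D' ws' w0' cover'.
- by rewrite -ltnS (leq_trans rr').
- by rewrite divr_gt0.
exists Z, key2, lab2, sigma2, om; split=> //; first exact: leq_trans XY YZ.
move=> N; rewrite [e]splitr; apply: le_trans (lerD (dist N) (dist2 N)).
by rewrite -big_split /=; apply: ler_sum => a _; apply: ler_distD.
Qed.

End merge_orbits.

(** * Drift weights *)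

Section prefix_gain.
Variables (T : finType) (f1 f2 : T -> 'I_#|T|).
Hypotheses (bij1 : bijective f1) (bij2 : bijective f2).

(* This is f2 g - f1 g, in a form whose sums over prefixes are differences of
   cardinals. *)
Definition position_gain (g : T) : int :=
  \sum_(i < #|T|) ((f1 g < i)%N%:Z - (f2 g < i)%N%:Z).

Let sum_lt (C : {set T}) (f : T -> 'I_#|T|) (i : nat) :
  \sum_(g in C) (f g < i)%N%:Z = #|C :&: [set g | (f g < i)%N]|%SET%:Z :> int.
Proof.
rewrite -sum1_card (eq_bigl (fun g => (g \in C) && (f g < i)%N)); last first.
  by move=> g; rewrite !inE.
rewrite big_mkcondr -[RHS]natz natr_sum.
by apply: eq_bigr => g _; case: ifP.
Qed.

Lemma sum_position_gain : \sum_g position_gain g = 0.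
Proof.
rewrite exchange_big big1 // => i _.
rewrite sumrB; have sumT (f : T -> 'I_#|T|) : bijective f ->
    \sum_g (f g < i)%N%:Z = i :> int.
  move=> bijf; rewrite -[in RHS](card_bij_prefix bijf (ltnW (ltn_ord i))).
  rewrite -[in RHS](finset.setTI [set g | (f g < i)%N]%SET) -sum_lt.
  by apply: eq_bigl => g; rewrite inE.
by rewrite !sumT// subrr.
Qed.

(** After exchanging the sums, the term of index [i] is [minn k i] minus the number of elements that
    are among the first [k] for [f1] and the first [i] for [f2]. It is never negative, and it is
    positive for [i = k] because the two prefixes differ. *)
Lemma prefix_gain k : (k < #|T|)%N ->
  [set g | (f1 g < k)%N]%SET <> [set g | (f2 g < k)%N]%SET ->
  1 <= \sum_(g | (f1 g < k)%N) position_gain g.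
Proof.
move=> kT neq; pose C := [set g | (f1 g < k)%N]%SET.
have cardC : #|C| = k by apply: card_bij_prefix => //; exact: ltnW.
have -> : \sum_(g | (f1 g < k)%N) position_gain g = \sum_(g in C) position_gain g.
  by apply: eq_bigl => g; rewrite inE.
rewrite exchange_big /=.
have card1 (i : nat) : (i <= #|T|)%N ->
    #|C :&: [set g | (f1 g < i)%N]|%SET = minn k i.
  move=> iT; rewrite -(@card_bij_prefix _ _ f1 (minn k i) bij1); last first.
    by rewrite geq_min iT orbT.
  by apply: eq_card => g; rewrite !inE leq_min.
have card2 (i : nat) : (i <= #|T|)%N ->
    (#|C :&: [set g | (f2 g < i)%N]|%SET <= minn k i)%N.
  move=> iT; rewrite leq_min; apply/andP; split.
    by rewrite -[leqRHS]cardC subset_leq_card// finset.subsetIl.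
  by rewrite -[leqRHS](card_bij_prefix bij2 iT) subset_leq_card// finset.subsetIr.
have card3 : (#|C :&: [set g | (f2 g < k)%N]|%SET < k)%N.
  have := card2 k (ltnW kT); rewrite minnn leq_eqVlt => /orP[/eqP eqk|//].
  case: neq; apply/eqP; rewrite -/C eqEcard cardC (card_bij_prefix bij2 (ltnW kT)).
  rewrite leqnn andbT; apply/finset.setIidPl/eqP.
  by rewrite eqEcard finset.subsetIl cardC eqk /=.
rewrite (bigD1 (Ordinal kT))//= sumrB !sum_lt card1 ?(ltnW kT)// minnn.
apply: ler_wpDr; last by lia.
apply: sumr_ge0 => i _; rewrite sumrB !sum_lt card1 ?(ltnW (ltn_ord i))//.
by have := card2 i (ltnW (ltn_ord i)); lia.
Qed.

End prefix_gain.

Lemma position_gainN (T : finType) (f1 f2 : T -> 'I_#|T|) g :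
  position_gain f2 f1 g = - position_gain f1 f2 g.
Proof. by rewrite -sumrN; apply: eq_bigr => i _; rewrite opprB. Qed.

Section drift.
Variables (Pi : grouped_permutation).
Hypotheses (Pi_irr : is_irreducible Pi) (Pi_proper : is_proper Pi).

Let d := #|groups Pi|.

(** Both sums are prefix sums of [t], written [P] for the top order and [Q] for the bottom order;
    the group of [a] itself is counted or not, depending on the side of [a] on which its
    representative lies. Proper nonempty prefixes have the right sign by irreducibility, the full
    one gives [kappa], the empty one 0. *)
Lemma drift_weights : exists t : groups Pi -> int,
  forall rep : groups Pi -> nat, (forall g, group_of Pi (rep g) = g) ->
  forall a, 1 <= \sum_(g | `[< left_top Pi (rep g) a >]) t g
                - \sum_(g | `[< left_bot Pi (rep g) a >]) t g.
Proof.
have d2 : (2 <= d)%N by exact: card_groups_ge2.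
have [g0 _] : exists g : groups Pi, g \in predT.
  by apply/card_gt0P; apply: leq_trans d2.
pose tail_across := exists g : groups Pi,
  [/\ kind g <> Single, pos_top g = 0%N :> nat & pos_bot g = d.-1 :> nat].
(* The gain of positions alone does not move the letters of a tail which is first
   on one side and last on the other.  The total weight kappa does, with a sign
   depending on the sides; properness excludes having both kinds of tails. *)
pose kappa : int := if pselect tail_across then -1 else 1.
have kappaE : kappa = 1 \/ kappa = -1 by rewrite /kappa; case: pselect; [right|left].
pose s := position_gain (@pos_top Pi) (@pos_bot Pi).
(* The factor 3 keeps the sums over proper nonempty prefixes at distance at least 2 from 0, whatever
   the sign of [kappa]. *)
pose t g := 3 * s g + kappa *+ (g == g0).
exists t => rep repE a.
pose P k := \sum_(g | (pos_top g < k)%N) t g.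
pose Q k := \sum_(g | (pos_bot g < k)%N) t g.
have sum_t (p : pred (groups Pi)) : \sum_(g | p g) t g =
    3 * \sum_(g | p g) s g + kappa *+ p g0.
  rewrite big_split /= -mulr_sumr; congr (_ + _).
  case: (boolP (p g0)) => pg0.
    rewrite (bigD1 g0)//= eqxx big1 ?addr0// => i /andP[_ /negbTE ->//].
  rewrite big1// => i pi; case: eqP => // ig.
  by rewrite -ig pi in pg0.
have P0 : P 0%N = 0 by rewrite /P big_pred0.
have Q0 : Q 0%N = 0 by rewrite /Q big_pred0.
have Pd : P d = kappa.
  rewrite /P sum_t ltn_ord (eq_bigl xpredT); last by move=> g; rewrite ltn_ord.
  by rewrite sum_position_gain ?mulr0 ?add0r//; [exact: pos_top_bij|exact: pos_bot_bij].
have Qd : Q d = kappa.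
  rewrite /Q sum_t ltn_ord (eq_bigl xpredT); last by move=> g; rewrite ltn_ord.
  by rewrite sum_position_gain ?mulr0 ?add0r//; [exact: pos_top_bij|exact: pos_bot_bij].
have Pk k : (0 < k < d)%N -> 2 <= P k.
  move=> kd; rewrite /P sum_t.
  have := prefix_gain (@pos_top_bij Pi) (@pos_bot_bij Pi) (k := k) _ (@Pi_irr k kd).
  rewrite -/s; have /andP[_ kd'] := kd; move=> /(_ kd').
  by case: (pos_top g0 < k)%N; rewrite ?mulr1n ?mulr0n;
    case: kappaE => kE; rewrite ?kE; lia.
have Qk k : (0 < k < d)%N -> Q k <= -2.
  move=> kd; rewrite /Q sum_t.
  have := prefix_gain (@pos_bot_bij Pi) (@pos_top_bij Pi) (k := k) _
    (fun e => @Pi_irr k kd (esym e)).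
  have /andP[_ kd'] := kd; move=> /(_ kd').
  have -> : \sum_(g | (pos_bot g < k)%N) position_gain (@pos_bot Pi) (@pos_top Pi) g =
      - \sum_(g | (pos_bot g < k)%N) s g.
    by rewrite -sumrN; apply: eq_bigr => g _; rewrite position_gainN.
  by case: (pos_bot g0 < k)%N; rewrite ?mulr1n ?mulr0n;
    case: kappaE => kE; rewrite ?kE; lia.
pose h := group_of Pi a.
pose Lt : bool := `[< left_top Pi (rep h) a >].
pose Lb : bool := `[< left_bot Pi (rep h) a >].
have topE : \sum_(g | `[< left_top Pi (rep g) a >]) t g = P (pos_top h + Lt)%N.
  apply: eq_bigl => g; have [->|gh] := eqVneq g h.
    by rewrite -/Lt; case: (Lt); rewrite ?addn1 ?addn0 ?ltnSn ?ltnn.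
  have neq : group_of Pi (rep g) <> group_of Pi a by rewrite repE; apply/eqP.
  rewrite (asbool_equiv_eq (left_top_group neq)) asboolb repE -/h.
  case: (Lt); rewrite ?addn0// addn1 ltnS [in RHS]leq_eqVlt.
  by case: eqP => // e; rewrite (pos_top_inj (val_inj e)) eqxx in gh.
have botE : \sum_(g | `[< left_bot Pi (rep g) a >]) t g = Q (pos_bot h + Lb)%N.
  apply: eq_bigl => g; have [->|gh] := eqVneq g h.
    by rewrite -/Lb; case: (Lb); rewrite ?addn1 ?addn0 ?ltnSn ?ltnn.
  have neq : group_of Pi (rep g) <> group_of Pi a by rewrite repE; apply/eqP.
  rewrite (asbool_equiv_eq (left_bot_group neq)) asboolb repE -/h.
  case: (Lb); rewrite ?addn0// addn1 ltnS [in RHS]leq_eqVlt.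
  by case: eqP => // e; rewrite (pos_bot_inj (val_inj e)) eqxx in gh.
rewrite topE botE.
have not_both : ~~ (Lt && Lb).
  apply/negP => /andP[/asboolP lt /asboolP lb].
  by apply: left_top_bot lt lb; rewrite repE.
have h_tail : Lt || Lb -> kind h <> Single.
  move=> L hS; have ra : rep h = a.
    exact: esym (single_group_eq hS (esym (repE h))).
  by move: L; rewrite /Lt /Lb ra => /orP[]/asboolP; [exact: left_top_irr|exact: left_bot_irr].
clearbody Lt Lb; clear topE botE.
have hd : (pos_top h < d)%N by exact: ltn_ord.
have hd' : (pos_bot h < d)%N by exact: ltn_ord.
have [pt ptE] : exists pt : nat, pt = pos_top h :> nat by eexists.
have [pb pbE] : exists pb : nat, pb = pos_bot h :> nat by eexists.
rewrite -ptE -pbE in hd hd' *.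
have [h00|h00] := boolP ((pt == 0%N) && (pb == 0%N)).
  have /andP[/eqP ht0 /eqP hb0] := h00.
  exfalso; apply: (@Pi_irr 1%N); first by rewrite -/d; lia.
  apply/setP => g; rewrite !inE !ltnS !leqn0 -{1}ht0 -hb0 ptE pbE.
  by apply/eqP/eqP => [/val_inj/pos_top_inj|/val_inj/pos_bot_inj] ->.
have : (pt + Lt)%N = 0%N \/ (0 < pt + Lt < d)%N \/
  (pt + Lt)%N = d by clear - hd d2; case: (Lt); rewrite ?addn1 ?addn0; lia.
have : (pb + Lb)%N = 0%N \/ (0 < pb + Lb < d)%N \/
  (pb + Lb)%N = d by clear - hd' d2; case: (Lb); rewrite ?addn1 ?addn0; lia.
case=> [mb|[mb|mb]] [mt|[mt|mt]].
- by exfalso; move: h00; case: (Lt) mt; case: (Lb) mb; lia.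
- by rewrite mb Q0; have := Pk _ mt; lia.
(* The group of [a] is a tail, first on the bottom and last on top. If [tail_across] held as well,
   both groups at the left end would be tails, against properness. *)
- rewrite mb mt Q0 Pd /kappa; case: pselect => // -[g [gS g0' gd]].
  exfalso; have hS : kind h <> Single by apply: h_tail; case: (Lt) mt; lia.
  have [[g' g'S [g't|g'b]] _] := Pi_proper.
    by apply: gS; have -> : g = g' by apply/pos_top_inj/val_inj; rewrite /= g0' g't.
  apply: hS; have -> : h = g' by apply/pos_bot_inj/val_inj; rewrite /= g'b -pbE; lia.
  by [].
- by rewrite mt P0; have := Qk _ mb; lia.
- by have := Pk _ mt; have := Qk _ mb; lia.
- by rewrite mt Pd; have := Qk _ mb; move: kappaE; lia.
(* Here the group of [a] is itself a witness of [tail_across]. *)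
- rewrite mb mt P0 Qd /kappa; case: pselect => // nt; exfalso; apply: nt.
  exists h; split; [|by rewrite -ptE; lia|by rewrite -pbE; case: (Lb) mb; lia].
  by apply: h_tail; case: (Lb) mb; lia.
- by rewrite mb Qd; have := Pk _ mt; move: kappaE; lia.
- by exfalso; move: not_both; case: (Lt) mt; case: (Lb) mb; lia.
Qed.

End drift.

(** * The simplex as a Baire space *)

Section simplex_metric.
Variable R : realType.
Implicit Types (lam mu : simplex R).

Lemma l1_dist_fin lam mu :
  (\sum_(0 <= i <oo) `|lam i - mu i|%:E)%E = (l1_dist lam mu)%:E.
Proof.
rewrite /l1_dist fineK// ge0_fin_numE; last first.
  by apply: nneseries_ge0 => i _ _; rewrite lee_fin.
apply: (@le_lt_trans _ _ (\sum_(0 <= i <oo) ((lam i)%:E + (mu i)%:E))%E).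
  apply: lee_nneseries => i _; first by rewrite lee_fin.
  rewrite -EFinD lee_fin (le_trans (ler_normB _ _))//.
  by rewrite !gtr0_norm ?len_gt0.
by rewrite nneseriesD ?len_sum ?ltry// => i _ _; rewrite lee_fin ltW ?len_gt0.
Qed.

Lemma l1_dist_partial lam mu N : \sum_(i < N) `|lam i - mu i| <= l1_dist lam mu.
Proof.
rewrite -lee_fin -l1_dist_fin -sumEFin.
rewrite -(big_mkord xpredT (fun i => `|lam i - mu i|%:E)).
by apply: nneseries_lim_ge => i _ _; rewrite lee_fin.
Qed.

Lemma l1_dist_le lam mu e :
  (forall N, \sum_(i < N) `|lam i - mu i| <= e) -> l1_dist lam mu <= e.
Proof.
move=> le_e; rewrite -lee_fin -l1_dist_fin; apply: lime_le.
  by apply: is_cvg_nneseries => i _ _; rewrite lee_fin.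
by apply: nearW => N; rewrite big_mkord sumEFin lee_fin.
Qed.

Lemma simplex_partial lam N : \sum_(i < N) lam i <= 1.
Proof.
rewrite -lee_fin -(len_sum lam) -sumEFin.
rewrite -(big_mkord xpredT (fun i => (lam i)%:E)).
by apply: nneseries_lim_ge => i _ _; rewrite lee_fin ltW ?len_gt0.
Qed.

Lemma simplex_partial_mono lam N M : (N <= M)%N ->
  \sum_(i < N) lam i <= \sum_(i < M) lam i.
Proof.
move=> /subnKC <-; rewrite big_split_ord /=.
by rewrite lerDl sumr_ge0// => i _; rewrite ltW ?len_gt0.
Qed.

Lemma simplex_tail lam e : 0 < e ->
  exists N0, forall N, (N0 <= N)%N -> 1 - e < \sum_(i < N) lam i.
Proof.
move=> e0; apply: contrapT => noN.
have : (\sum_(0 <= i <oo) (lam i)%:E <= (1 - e)%:E)%E.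
  apply: lime_le.
    by apply: is_cvg_nneseries => i _ _; rewrite lee_fin ltW ?len_gt0.
  apply: nearW => N; rewrite big_mkord sumEFin lee_fin leNgt; apply/negP => lt.
  apply: noN; exists N => M NM; apply: lt_le_trans lt _.
  exact: simplex_partial_mono.
by rewrite len_sum lee_fin; lra.
Qed.

Lemma simplex_build (l : nat -> R) : (forall i, 0 < l i) ->
  (forall N, \sum_(i < N) l i <= 1) ->
  (forall e, 0 < e -> exists N, 1 - e <= \sum_(i < N) l i) ->
  exists lam : simplex R, len lam = l.
Proof.
move=> l0 l1 lsup.
suff lE : (\sum_(0 <= i <oo) (l i)%:E = 1)%E by exists (Simplex l0 lE).
have lge0 i : (0 <= (l i)%:E)%E by rewrite lee_fin ltW.
apply/eqP; rewrite eq_le; apply/andP; split.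
  apply: lime_le; first by apply: is_cvg_nneseries => i _ _.
  by apply: nearW => N; rewrite big_mkord sumEFin lee_fin.
apply/lee_addgt0Pr => e e0; have [N le] := lsup e e0.
apply: (@le_trans _ _ ((\sum_(i < N) l i)%:E + e%:E)%E).
  by rewrite -EFinD lee_fin; lra.
rewrite leeD2r// -sumEFin -(big_mkord xpredT (fun i => (l i)%:E)).
by apply: nneseries_lim_ge.
Qed.

Lemma mdist_simplex lam mu : mdist lam mu = l1_dist lam mu.
Proof. by []. Qed.

Lemma ball_simplex lam e : ball lam e = [set mu | l1_dist lam mu < e].
Proof. by rewrite ballEmdist. Qed.

(* The third hypothesis keeps the coordinates of the limit positive. *)
Lemma nested_l1_balls (lam : nat -> simplex R) (r : nat -> R) :
  (forall n, 0 < r n) ->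
  (forall n m, (n <= m)%N -> l1_dist (lam n) (lam m) <= r n) ->
  (forall n, r n.+1 <= lam n.+1 n / 2) -> (forall n, r n.+1 <= n.+1%:R^-1) ->
  exists mu : simplex R, forall n, l1_dist (lam n) mu <= r n.
Proof.
move=> r0 lamr rlam rn.
have coordr n m i : (n <= m)%N -> `|lam n i - lam m i| <= r n.
  move=> nm; apply: le_trans (lamr n m nm).
  apply: le_trans (l1_dist_partial _ _ i.+1).
  by rewrite big_ord_recr /= lerDr sumr_ge0.
have coordrr n m i : lam n i - r n <= lam m i + r m.
  have [nm|/ltnW mn] := leqP n m.
    have := coordr n m i nm; have := r0 m; rewrite ler_norml => ? /andP[]; lra.
  have := coordr m n i mn; have := r0 n; rewrite ler_norml => ? /andP[]; lra.
(* By [coordrr] each of these lower bounds is below each [lam m i + r m], which places the supremum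
   within [r n] of every [lam n i]. *)
pose l i := sup [set lam n i - r n | n in [set: nat]].
have hs i : has_sup [set lam n i - r n | n in [set: nat]].
  split; first by exists (lam 0 i - r 0), 0%N.
  by exists (lam 0 i + r 0) => _ [n _ <-].
have lr n i : `|lam n i - l i| <= r n.
  have lower : lam n i - r n <= l i.
    by apply: ub_le_sup; [exact: (hs i).2|exists n].
  have upper : l i <= lam n i + r n.
    by apply: ge_sup; [exact: (hs i).1|move=> _ [m _ <-]].
  rewrite ler_norml; apply/andP; split; lra.
have r_small e : 0 < e -> exists n, r n < e.
  move=> e0; exists (Num.truncn e^-1).+1; apply: le_lt_trans (rn _) _.
  rewrite -[ltRHS]invrK ltf_pV2 ?posrE ?ltr0n ?invr_gt0//.
  exact: truncnS_gt.
have l1r n N : \sum_(i < N) `|lam n i - l i| <= r n.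
  apply/ler_addgt0Pr => e e0.
  have [k rk] : exists k, r k < e / (N.+1%:R * 2).
    by apply: r_small; rewrite divr_gt0// mulr_gt0.
  (* At stage [m] the coordinates are so close to their limits that even the sum of [N] errors is
     below [e]; the distance from stage [n] to stage [m] is controlled by [lamr]. *)
  pose m := maxn n k.
  have rke m' : (k <= m')%N -> \sum_(i < N) `|lam m' i - l i| <= e.
    move=> km.
    apply: (@le_trans _ _ (\sum_(i < N) (r k + r k))).
      apply: ler_sum => i _; have := coordr k m' i km; have := lr k i.
      by rewrite !ler_norml => /andP[? ?] /andP[? ?]; apply/andP; split; lra.
    move: rk; rewrite ltr_pdivlMr ?mulr_gt0// -natr1 sumr_const card_ord -mulr_natr.
    by have := r0 k; lra.
  apply: (@le_trans _ _ (\sum_(i < N) (`|lam n i - lam m i| + `|lam m i - l i|))).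
    by apply: ler_sum => i _; apply: ler_distD.
  rewrite big_split /= lerD ?rke ?leq_maxr//.
  apply: le_trans (lamr n m (leq_maxl _ _)); exact: l1_dist_partial.
have lpos i : 0 < l i.
  have := lr i.+1 i; have := rlam i; have := len_gt0 (lam i.+1) i.
  by rewrite ler_norml => ? ? /andP[? ?]; lra.
have sum_near n N : \sum_(i < N) lam n i - r n <= \sum_(i < N) l i <=
    \sum_(i < N) lam n i + r n.
  have : `|\sum_(i < N) (lam n i - l i)| <= r n.
    exact: le_trans (ler_norm_sum _ _ _) (l1r n N).
  by rewrite sumrB ler_norml => /andP[? ?]; apply/andP; split; lra.
have [||mu muE] := simplex_build lpos.
- move=> N; apply/ler_addgt0Pr => e e0; have [n rne] := r_small e e0.
  have /andP[_ up] := sum_near n N; apply: le_trans up _.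
  by rewrite lerD ?simplex_partial// ltW.
- move=> e e0; have [|n rne] := r_small (e / 2); first by rewrite divr_gt0.
  have [|N /(_ N (leqnn _)) tl] := @simplex_tail (lam n) (e / 2); first by rewrite divr_gt0.
  by exists N; have /andP[low _] := sum_near n N; lra.
by exists mu => n; apply: l1_dist_le => N; rewrite muE.
Qed.

(** The simplex is not complete for the l^1 distance, since coordinates can tend to 0. The usual
    nested balls are therefore also kept away from the faces, the coordinate [n] being protected at
    stage [n]. *)
Lemma simplex_Baire (U : nat -> set (simplex R)) :
  (forall n, open (U n)) -> (forall n, dense (U n)) -> dense (\bigcap_n U n).
Proof.
move=> Uo Ud O [lam0 Olam0] Oo.
have step (p : nat * (simplex R * R)) : exists q : simplex R * R, 0 < p.2.2 ->
    [/\ 0 < q.2, forall mu, l1_dist q.1 mu <= q.2 -> U p.1 mu,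
      l1_dist p.2.1 q.1 + q.2 <= p.2.2, q.2 <= q.1 p.1 / 2 & q.2 <= p.1.+1%:R^-1].
  case: p => n [lam r] /=.
  have [r0|r0] := ltP 0 r; last by exists (lam, r); rewrite ltNge r0.
  have [mu [bmu Umu]] : ball lam r `&` U n !=set0.
    have [|mu [/interior_subset ? ?]] := Ud n _ _ (open_interior (ball lam r)).
      by exists lam; apply: nbhsx_ballx.
    by exists mu.
  have := open_nbhs_nbhs (conj (Uo n) Umu); move=> /nbhs_ballP[e /= e0 beU].
  move: bmu; rewrite ball_simplex /= => lm.
  (* In this order: stay inside [U n], stay inside the previous ball, keep coordinate [n] positive,
     shrink to 0. *)
  pose r' := Num.min (Num.min (e / 2) (r - l1_dist lam mu)) (Num.min (mu n / 2) n.+1%:R^-1).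
  have r'1 : r' <= e / 2 by rewrite !ge_min lexx.
  have r'2 : r' <= r - l1_dist lam mu by rewrite !ge_min lexx orbT.
  have r'3 : r' <= mu n / 2 by rewrite !ge_min lexx !orbT.
  have r'4 : r' <= n.+1%:R^-1 by rewrite !ge_min lexx !orbT.
  have r'0 : 0 < r'.
    by rewrite !lt_min !divr_gt0 ?len_gt0//= subr_gt0 lm invr_gt0 ltr0n.
  exists (mu, r') => _ /=; split=> //; last by lra.
  move=> nu lnu; apply: beU; rewrite ball_simplex /=.
  by rewrite (le_lt_trans lnu)// (le_lt_trans r'1)//; lra.
have [f fP] := choice step.
have := open_nbhs_nbhs (conj Oo Olam0); move=> /nbhs_ballP[e /= e0 beO].
pose s n := iteri n (fun k p => f (k, p)) (lam0, e / 2).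
have s0 n : 0 < (s n).2.
  elim: n => [|n IHn] /=; first by rewrite divr_gt0.
  by have [] := fP (n, s n) IHn.
have sP n := fP (n, s n) (s0 n).
have sdist n k : l1_dist (s n).1 (s (n + k)%N).1 + (s (n + k)%N).2 <= (s n).2.
  elim: k => [|k IHk].
    by rewrite addn0 -mdist_simplex mdistxx add0r.
  have [_ _ h _ _] := sP (n + k)%N; rewrite addnS /= in h *.
  have := metric_triangle (s n).1 (s (n + k)%N).1 (f ((n + k)%N, s (n + k)%N)).1.
  rewrite !mdist_simplex; move: IHk h; lra.
have [||||mu muP] := @nested_l1_balls (fun n => (s n).1) (fun n => (s n).2).
- exact: s0.
- move=> n m nm; rewrite -(subnKC nm); have := sdist n (m - n)%N.
  by have := s0 (n + (m - n))%N; lra.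
- by move=> n; have [] := sP n.
- by move=> n; have [] := sP n.
exists mu; split.
  apply: beO; rewrite ball_simplex /=; apply: le_lt_trans (muP 0%N) _ => /=; lra.
by move=> n _; have [_ h _ _ _] := sP n; apply: h; exact: (muP n.+1).
Qed.

End simplex_metric.

(** * Invariance of Lebesgue measure *)

Section letter_sums.
Variables (R : realType) (lam : simplex R).
Implicit Types A B : set nat.

Definition letter_sum A : R := fine (\esum_(b in A) (lam b)%:E)%E.

Lemma letter_sum_partial_ge A N M :
  \sum_(i < M | (i : nat) \in A) lam i <=
  \sum_(i < N | (i : nat) \in A) lam i + (1 - \sum_(i < N) lam i).
Proof.
have pos i : 0 <= lam i by rewrite ltW ?len_gt0.
have mono k : \sum_(i < M | (i : nat) \in A) lam i <=
    \sum_(i < M + k | (i : nat) \in A) lam i.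
  by rewrite big_split_ord /= lerDl sumr_ge0.
apply: le_trans (mono N) _; rewrite addnC big_split_ord /= lerD2l lerBrDl.
apply: le_trans (simplex_partial lam (N + M)); rewrite big_split_ord /= lerD2l.
by rewrite big_mkcond /=; apply: ler_sum => i _; case: ifP.
Qed.

Lemma letter_sumE A : (\esum_(b in A) (lam b)%:E = (letter_sum A)%:E)%E.
Proof.
have pos i : (0 <= (lam i)%:E)%E by rewrite lee_fin ltW ?len_gt0.
rewrite /letter_sum fineK// ge0_fin_numE ?esum_ge0//.
apply: (@le_lt_trans _ _ 1%E); last by rewrite ltry.
rewrite -[A]set_mem_set -nneseries_esum//; apply: lime_le.
  exact: is_cvg_nneseries_cond.
apply: nearW => M; rewrite (big_mkord (fun i => i \in A)) sumEFin lee_fin.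
by have := letter_sum_partial_ge A 0 M; rewrite !big_ord0 add0r subr0.
Qed.

Lemma letter_sum_ge A N : \sum_(i < N | (i : nat) \in A) lam i <= letter_sum A.
Proof.
have pos i : (0 <= (lam i)%:E)%E by rewrite lee_fin ltW ?len_gt0.
rewrite -lee_fin -letter_sumE -[A in leRHS]set_mem_set -nneseries_esum//.
rewrite -sumEFin -(big_mkord (fun i => i \in A) (fun i => (lam i)%:E)).
exact: nneseries_lim_ge.
Qed.

Lemma letter_sum_le A N : letter_sum A <=
  \sum_(i < N | (i : nat) \in A) lam i + (1 - \sum_(i < N) lam i).
Proof.
have pos i : (0 <= (lam i)%:E)%E by rewrite lee_fin ltW ?len_gt0.
rewrite -lee_fin -letter_sumE -[A in leLHS]set_mem_set -nneseries_esum//.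
apply: lime_le; first exact: is_cvg_nneseries_cond.
apply: nearW => M; rewrite (big_mkord (fun i => i \in A)) sumEFin lee_fin.
exact: letter_sum_partial_ge.
Qed.

Lemma letter_sum_ge0 A : 0 <= letter_sum A.
Proof. by have := letter_sum_ge A 0; rewrite big_ord0. Qed.

Lemma letter_sum_le1 A : letter_sum A <= 1.
Proof. by have := letter_sum_le A 0; rewrite !big_ord0 add0r subr0. Qed.

Lemma letter_sum_add A B a : A `<=` B -> B a -> ~ A a ->
  letter_sum A + lam a <= letter_sum B.
Proof.
move=> AB Ba nAa; apply/ler_addgt0Pr => e e0.
have [N0 tail] := simplex_tail lam e0; pose N := maxn N0 a.+1.
have aN : (a < N)%N by rewrite leq_maxr.
have := tail N (leq_maxl _ _); have := letter_sum_le A N; have := letter_sum_ge B N.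
suff : \sum_(i < N | (i : nat) \in A) lam i + lam a <=
       \sum_(i < N | (i : nat) \in B) lam i by lra.
rewrite [leRHS](bigD1 (Ordinal aN)) /=; last by rewrite inE.
rewrite [leLHS]addrC lerD2l big_mkcond [leRHS]big_mkcond /=; apply: ler_sum => i _.
have pos : 0 <= lam i by rewrite ltW ?len_gt0.
have [iA|_] := boolP ((i : nat) \in A); last by case: ifP.
have -> : (i : nat) \in B by rewrite inE; apply: AB; rewrite inE in iA.
case: eqP => //= ia; exfalso; apply: nAa; rewrite inE in iA.
by move: iA; rewrite ia.
Qed.

(** Uniform in [A], which may be infinite: in this way a finitely supported model controls the ends
    of all intervals at once. *)
Lemma letter_sum_approx A N0 (l : nat -> R) e :
  (forall i, (N0 <= i)%N -> l i = 0) ->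
  (forall N, \sum_(i < N) `|lam i - l i| <= e) ->
  `|letter_sum A - \sum_(i < N0 | (i : nat) \in A) l i| <= e.
Proof.
move=> l0 le_e; apply/ler_addgt0Pr => d d0.
have [N1 tail] := simplex_tail lam d0; pose N := (N0 + N1)%N.
have lE : \sum_(i < N | (i : nat) \in A) l i = \sum_(i < N0 | (i : nat) \in A) l i.
  rewrite big_split_ord /= [X in _ + X]big1 ?addr0// => i _.
  by rewrite l0//= leq_addr.
have diff : `|\sum_(i < N | (i : nat) \in A) lam i -
              \sum_(i < N | (i : nat) \in A) l i| <= e.
  apply: le_trans (le_e N); rewrite -sumrB.
  apply: le_trans (ler_norm_sum _ _ _) _.
  by rewrite big_mkcond; apply: ler_sum => i _; case: ifP.
have := tail N (leq_addl _ _); have := letter_sum_le A N; have := letter_sum_ge A N.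
move: diff; rewrite lE !ler_norml => /andP[? ?] ? ? ?; apply/andP; split; lra.
Qed.

Section layout.
Variable left : nat -> nat -> Prop.
Hypothesis left_irr : forall a, ~ left a a.
Hypothesis left_trans : forall a b c, left a b -> left b c -> left a c.
Hypothesis left_total : forall a b, [\/ a = b, left a b | left b a].

(** Unfolds to [top_left] or [bot_left] according to the order [left], so that both lines are
    treated together. *)
Definition layout_left a : R := letter_sum [set b | left b a].

Definition layout_itv a : set R :=
  `]layout_left a, (layout_left a + lam a)[%classic.

Lemma layout_left_ge0 a : 0 <= layout_left a.
Proof. exact: letter_sum_ge0. Qed.

Lemma layout_right_le1 a : layout_left a + lam a <= 1.
Proof.
apply: le_trans (letter_sum_le1 setT); apply: letter_sum_add => //.
exact: left_irr.
Qed.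

Lemma layout_left_lt a b : left a b -> layout_left a + lam a <= layout_left b.
Proof.
move=> ab; apply: letter_sum_add => //; last exact: left_irr.
by move=> c /= ca; apply: left_trans ab.
Qed.

Lemma layout_disjoint a b x : layout_itv a x -> layout_itv b x -> a = b.
Proof.
rewrite /layout_itv /= !in_itv /= => /andP[a1 a2] /andP[b1 b2].
by have [//|/layout_left_lt ?|/layout_left_lt ?] := left_total a b; exfalso; lra.
Qed.

Lemma trivIset_layout : trivIset setT layout_itv.
Proof. by move=> a b _ _ [x [ax bx]]; apply: layout_disjoint bx. Qed.

Lemma layout_sub01 a : layout_itv a `<=` `[0, 1].
Proof.
move=> x; rewrite /layout_itv /= !in_itv /= => /andP[a1 a2].
by have := layout_left_ge0 a; have := layout_right_le1 a; move=> ? ?; apply/andP; split; lra.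
Qed.

Lemma measurable_layout a : measurable (layout_itv a : set (measurableTypeR R)).
Proof. exact: measurable_itv. Qed.

Lemma measurable_layout_bigcup :
  measurable (\bigcup_a layout_itv a : set (measurableTypeR R)).
Proof. by apply: bigcup_measurable => a _; exact: measurable_layout. Qed.

Lemma lebesgue_layout a : lebesgue_measure (layout_itv a) = (lam a)%:E.
Proof.
rewrite /layout_itv lebesgue_measure_itv /= lte_fin ltrDl len_gt0.
by rewrite -EFinD addrAC subrr add0r.
Qed.

Lemma lebesgue_layout_bigcup : lebesgue_measure (\bigcup_a layout_itv a) = 1%E.
Proof.
rewrite measure_bigcup; [|by move=> a _; exact: measurable_layout|exact: trivIset_layout].
rewrite -[RHS](len_sum lam) eseries_mkcond; apply: eq_eseriesr => a _.
by rewrite in_setT; exact: lebesgue_layout.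
Qed.

End layout.

End letter_sums.

Section unit_lebesgue.
Variable R : realType.
Local Notation leb := (@lebesgue_measure R).
Local Notation P := (uniform_prob (@ltr01 R) : probability (measurableTypeR R) R).

Lemma uniform01E (A : set (measurableTypeR R)) : measurable A ->
  P A = leb (A `&` `[0, 1]%classic).
Proof.
move=> mA; transitivity (\int[leb]_(x in A) (uniform_pdf 0 1 x)%:E)%E => //.
rewrite integral_uniform_pdf.
rewrite (eq_integral (fun=> 1%:E)); last first.
  move=> x; rewrite inE => -[_ /=]; rewrite in_itv /= => x01.
  by rewrite /uniform_pdf x01 subr0 invr1.
by rewrite integral_cst ?mul1e//; apply: measurableI.
Qed.

Lemma lebesgue_shift c (A : set (measurableTypeR R)) : measurable A ->
  leb ((fun x => x + c) @^-1` A) = leb A.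
Proof.
move=> mA; have ms : measurable_fun [set: measurableTypeR R]
    (fun x => x + c : measurableTypeR R).
  by apply: measurable_funD => //; exact: measurable_id.
rewrite -/(pushforward leb (fun x => x + c : measurableTypeR R) A).
apply/esym/lebesgue_measure_unique => //= _ [[a b]] _ <-.
rewrite /pushforward.
have -> : (fun x => x + c) @^-1` `]a, b]%classic = `]a - c, b - c]%classic.
  by apply/seteqP; split=> x /=; rewrite !in_itv /= ltrBlDr lerBrDr.
rewrite !lebesgue_measure_itv /= !lte_fin ltrD2r.
by case: ifP => // _; rewrite -!EFinD; congr EFin; lra.
Qed.

End unit_lebesgue.

Section iet_lebesgue.
Variables (R : realType) (Pi : grouped_permutation) (lam : simplex R).
Local Notation leb := (@lebesgue_measure R).
Local Notation P := (uniform_prob (@ltr01 R) : probability (measurableTypeR R) R).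
Local Notation T := (iet Pi lam).

Lemma ietE a x : top_itv Pi lam a x ->
  T x = x - top_left Pi lam a + bot_left Pi lam a.
Proof.
move=> ax; rewrite /iet; case: xgetP => [y _ [b bx ->]|]; last first.
  by move=> /(_ (x - top_left Pi lam a + bot_left Pi lam a)) /=; case; exists a.
suff -> : a = b by [].
exact: (layout_disjoint (@left_top_irr Pi) (@left_top_trans Pi)
  (@left_top_total Pi) ax bx).
Qed.

Lemma measurable_top_itv a : measurable (top_itv Pi lam a : set (measurableTypeR R)).
Proof. exact: measurable_itv. Qed.

Lemma measurable_iet_dom : measurable (iet_dom Pi lam : set (measurableTypeR R)).
Proof. by apply: bigcup_measurable => a _; exact: measurable_top_itv. Qed.

Lemma iet_out x : ~ iet_dom Pi lam x -> T x = 0.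
Proof.
move=> nx; rewrite /iet; case: xgetP => // y _ [a ax _].
by exfalso; apply: nx; exists a.
Qed.

Lemma measurable_iet :
  measurable_fun [set: measurableTypeR R] (T : measurableTypeR R -> measurableTypeR R).
Proof.
rewrite -(setUv (iet_dom Pi lam)); apply/measurable_funU.
- exact: measurable_iet_dom.
- exact: measurableC measurable_iet_dom.
split.
  apply/measurable_fun_bigcup; first by move=> a; exact: measurable_top_itv.
  move=> a; apply: (@eq_measurable_fun _ _ (measurableTypeR R) (measurableTypeR R) _
      (fun x => x - top_left Pi lam a + bot_left Pi lam a)).
    by move=> x; rewrite inE => /ietE ->.
  apply: measurable_funD => //; apply: measurable_funB => //.
apply: (@eq_measurable_fun _ _ (measurableTypeR R) (measurableTypeR R) _ (fun=> 0)) => //.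
by move=> x; rewrite inE => /iet_out ->.
Qed.

Lemma measurable_iet_preimage (A : set (measurableTypeR R)) : measurable A ->
  measurable (T @^-1` A : set (measurableTypeR R)).
Proof. by move=> mA; rewrite -[X in measurable X]setTI; apply: measurable_iet. Qed.

(** On each top interval the preimage of [A] is a translate of the part of [A] in the bottom
    interval, and the disjoint bottom intervals have total length 1, so they miss only a null part
    of [A]. *)
Lemma uniform_iet_invariant : iet_invariant Pi lam P.
Proof.
split.
  by rewrite uniform01E ?setIid ?lebesgue_measure_itv/= ?lte_fin ?ltr01 ?oppr0 ?adde0.
move=> A mA.
pose c a := bot_left Pi lam a - top_left Pi lam a.
pose Tp a : set (measurableTypeR R) := top_itv Pi lam a.
pose Bt a : set (measurableTypeR R) := layout_itv lam (left_bot Pi) a.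
have bot01 := layout_sub01 (lam := lam) (@left_bot_irr Pi).
have top01 := layout_sub01 (lam := lam) (@left_top_irr Pi).
have mBt a : measurable (Bt a) by exact: measurable_layout.
have disjB := trivIset_layout (lam := lam)
  (@left_bot_irr Pi) (@left_bot_trans Pi) (@left_bot_total Pi).
have disjT := trivIset_layout (lam := lam)
  (@left_top_irr Pi) (@left_top_trans Pi) (@left_top_total Pi).
have domE : iet_dom Pi lam `&` T @^-1` A = \bigcup_a (Tp a `&` T @^-1` A).
  by rewrite setI_bigcupl.
have TpE a : Tp a `&` T @^-1` A = (fun x => x + c a) @^-1` (Bt a `&` A).
  have shift x : Tp a x <-> Bt a (x + c a).
    rewrite /Tp /Bt /layout_itv /c /= /top_itv /= !in_itv /=.
    rewrite -[layout_left lam (left_bot Pi) a]/(bot_left Pi lam a).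
    by split=> /andP[? ?]; apply/andP; split; lra.
  apply/seteqP; split=> x /=.
    move=> [Tx]; rewrite (ietE Tx) addrAC -addrA => Ax; split=> //.
    exact/shift.
  by move=> [/shift Tx Ax]; split=> //; rewrite (ietE Tx) addrAC -addrA.
have mTT a : measurable (Tp a `&` T @^-1` A).
  apply: measurableI; first exact: measurable_top_itv.
  exact: measurable_iet_preimage.
have mBA a : measurable (Bt a `&` A) by exact: measurableI.
rewrite domE measure_bigcup//; last first.
- by apply: trivIset_setIr; exact: disjT.
transitivity (\sum_(i <oo | i \in [set: nat]) P (Bt i `&` A))%E.
  apply: eq_eseriesr => a _.
  have PT : P (Tp a `&` T @^-1` A) = leb (Tp a `&` T @^-1` A).
    by rewrite (uniform01E (mTT a)) setIidl// => x [/top01].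
  have PB : P (Bt a `&` A) = leb (Bt a `&` A).
    by rewrite (uniform01E (mBA a)) setIidl// => x [/bot01].
  apply: (etrans PT); apply/esym/(etrans PB).
  by rewrite TpE lebesgue_shift.
rewrite -measure_bigcup//; last first.
- by apply: trivIset_setIr; exact: disjB.
rewrite -setI_bigcupl setIC.
pose B := \bigcup_a Bt a.
have mB : measurable B by exact: measurable_layout_bigcup.
have PB : P (~` B) = 0%E.
  rewrite probability_setC//.
  have -> : P B = 1%E.
    rewrite uniform01E// setIidl; last by move=> x [a _ /bot01].
    exact: (lebesgue_layout_bigcup lam
      (@left_bot_irr Pi) (@left_bot_trans Pi) (@left_bot_total Pi)).
  by rewrite subee.
rewrite -[in RHS](setIT A) -(setUv B) setIUr measureU//.
- rewrite [X in (_ + X)%E](_ : _ = 0%E) ?adde0//.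
  apply/eqP; rewrite eq_le measure_ge0 andbT -PB le_measure ?inE//.
  + by apply: measurableI => //; exact: measurableC.
  + exact: measurableC.
- exact: measurableI.
- by apply: measurableI => //; exact: measurableC.
- by rewrite setIACA setICr setI0.
Qed.

(** A bound on the Kolmogorov distance (the supremum distance of distribution functions) between any
    invariant measure and the uniform one. *)
Definition equidistributed (e : R) :=
  forall nu : probability (measurableTypeR R) R, iet_invariant Pi lam nu ->
  forall a, 0 <= a <= 1 -> `|fine (nu `]-oo, a]%classic) - a| <= e.

Lemma uniquely_ergodic_equidistributed :
  (forall n, equidistributed n.+1%:R^-1) -> uniquely_ergodic Pi lam.
Proof.
move=> eqd; exists P; split; first exact: uniform_iet_invariant.
suff ray (nu : probability (measurableTypeR R) R) : iet_invariant Pi lam nu ->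
    forall a, nu `]-oo, a]%classic = (Num.max 0 (Num.min a 1))%:E.
  move=> nu nuI A mA; have rayE a : nu `]-oo, a]%classic = P `]-oo, a]%classic.
    by rewrite !ray//; exact: uniform_iet_invariant.
  apply: (@measure_unique _ _ (measurableTypeR R) (@ocitv R)
    (fun n => `]-(n%:R), n%:R]%classic)) => //.
  - exact: ocitvI.
  - by move=> i; exact: is_ocitv.
  - apply/seteqP; split=> // x _; exists (Num.truncn `|x|).+1 => //=.
    rewrite in_itv /=; have := truncnS_gt `|x|; rewrite ltr_norml => /andP[-> /ltW ->//].
  - move=> _ [[a b] _ <-] /=; have [ab|ba] := leP a b; last first.
      by rewrite set_itv_ge ?measure0// bnd_simp -leNgt ltW.
    have -> : `]a, b]%classic = `]-oo, b]%classic `\` `]-oo, a]%classic :> set R.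
      apply/seteqP; split=> x /=; rewrite !in_itv /=.
        by move=> /andP[ax xb]; split=> //; apply/negP; rewrite -ltNge.
      by move=> [xb /negP]; rewrite -ltNge xb => ->.
    have sub : `]-oo, b]%classic `&` `]-oo, a]%classic = `]-oo, a]%classic :> set R.
      apply/seteqP; split=> x /=; rewrite !in_itv /=; first by case.
      by move=> xa; split=> //; apply: le_trans ab.
    have measD (Q : probability (measurableTypeR R) R) :
        Q (`]-oo, b]%classic `\` `]-oo, a]%classic) =
        (Q `]-oo, b]%classic - Q `]-oo, a]%classic)%E.
      rewrite measureD//; first by rewrite sub.
      by rewrite (le_lt_trans (probability_le1 _ _)) ?ltry.
    by rewrite !measD !rayE.
  - by move=> k; rewrite (le_lt_trans (probability_le1 _ _)) ?ltry.
move=> [nu01 nuI] a.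
have lo b : b < 0 -> nu `]-oo, b]%classic = 0%E.
  move=> b0; apply/eqP; rewrite eq_le measure_ge0 andbT.
  have -> : 0%E = nu (~` `[0, 1]%classic).
    by rewrite probability_setC// -/(nu _) nu01 subee.
  rewrite le_measure ?inE//; first exact: measurableC.
  by move=> x /=; rewrite !in_itv /= => xb; apply/negP; rewrite negb_and -!ltNge (le_lt_trans xb).
have hi b : 1 <= b -> nu `]-oo, b]%classic = 1%E.
  move=> b1; apply/eqP; rewrite eq_le probability_le1//= -nu01.
  rewrite le_measure ?inE// => x /=; rewrite !in_itv /= => /andP[_ x1].
  exact: le_trans b1.
have [a0|a0] := ltP a 0; first by rewrite lo// min_l ?max_l//; lra.
have [a1|a1] := leP 1 a; first by rewrite hi// max_r.
rewrite max_r; last by lra.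
rewrite -[LHS]fineK; last by rewrite fin_num_measure.
congr EFin; apply/eqP; rewrite -subr_eq0 -normr_le0; apply/ler_addgt0Pr => e e0.
rewrite add0r; have a01 : 0 <= a <= 1 by apply/andP; split; lra.
apply: le_trans (eqd (Num.truncn e^-1) nu (conj nu01 nuI) a a01) _.
rewrite -[leRHS]invrK lef_pV2 ?posrE ?ltr0n ?invr_gt0//.
by apply/ltW; exact: truncnS_gt.
Qed.

End iet_lebesgue.

(** * Exchanges close to a finite model *)

Section cell_rank.
Variables (Pi : grouped_permutation) (X : finType) (key lab : X -> nat).
Variables (sigma : X -> X).
Hypothesis D : discrete_iet Pi key lab sigma.

(** Keys may have gaps. The rank is the true index of a cell, which thus stands for the interval
    from [omega * cell_rank x] to [omega * (cell_rank x).+1]. *)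
Definition cell_rank (x : X) := #|[set y | (key y < key x)%N]%SET|.
Definition cells_in (A : set nat) := #|[set y | lab y \in A]%SET|.

Lemma cell_rank_lt x y : (cell_rank x < cell_rank y)%N = (key x < key y)%N.
Proof.
have mono u v : (key u < key v)%N -> (cell_rank u < cell_rank v)%N.
  move=> uv; apply: proper_card; apply/fintype.properP; split.
    by apply/fintype.subsetP => z; rewrite !inE => /ltn_trans; apply.
  by exists u; rewrite !inE ?ltnn.
apply/idP/idP => [xy|/mono//]; rewrite ltnNge; apply/negP.
rewrite leq_eqVlt => /orP[/eqP/(key_inj D) yx|/mono yx].
  by rewrite yx ltnn in xy.
by rewrite ltnNge (ltnW yx) in xy.
Qed.

Lemma cell_rank_inj : injective cell_rank.
Proof.
move=> x y xy; apply: (key_inj D); have [||//] := ltngtP (key x) (key y).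
  by rewrite -(cell_rank_lt x y) xy ltnn.
by rewrite -(cell_rank_lt y x) xy ltnn.
Qed.

Lemma cell_rank_ltn x : (cell_rank x < #|X|)%N.
Proof.
rewrite -cardsT; apply: proper_card; rewrite properT.
by apply/eqP => /setP /(_ x); rewrite !inE ltnn.
Qed.

Definition cell_ord x : 'I_#|X| := Ordinal (cell_rank_ltn x).

Lemma cell_ord_bij : bijective cell_ord.
Proof.
apply: inj_card_bij; last by rewrite card_ord.
by move=> x y /(congr1 val) /cell_rank_inj.
Qed.

Lemma cell_rank_surj n : (n < #|X|)%N -> exists x, cell_rank x = n.
Proof.
by case: cell_ord_bij => g _ gK nX; exists (g (Ordinal nX)); rewrite -[LHS]/(val (cell_ord _)) gK.
Qed.

Lemma cells_inU A B : A `&` B = set0 ->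
  cells_in (A `|` B) = (cells_in A + cells_in B)%N.
Proof.
move=> AB; rewrite /cells_in -cardsUI.
rewrite [X in (_ = _ + X)%N](_ : _ = 0%N) ?addn0.
  by apply: eq_card => y; rewrite !inE in_setU.
apply/eqP; rewrite cards_eq0; apply/eqP/setP => y; rewrite !inE.
by apply/negP => /andP[/set_mem yA /set_mem yB]; have : (A `&` B) (lab y) by []; rewrite AB.
Qed.

Lemma cells_in_mono A B : A `<=` B -> (cells_in A <= cells_in B)%N.
Proof.
move=> AB; apply: subset_leq_card; apply/fintype.subsetP => y.
by rewrite !finset.in_set => /set_mem/AB/mem_set.
Qed.

Lemma cells_in_addr (left : nat -> nat -> Prop) a :
  (forall a, ~ left a a) ->
  cells_in ([set b | left b a] `|` [set a]) =
  (cells_in [set b | left b a] + cells_in [set a])%N.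
Proof.
move=> irr; apply: cells_inU; apply/seteqP; split=> // b [/= ba beq].
by apply: (irr a); rewrite -{1}beq.
Qed.

Let lower x := #|[set y | (lab y == lab x) && (key y < key x)%N]%SET|.

Let rank_split x : cell_rank x = (cells_in [set b | left_top Pi b (lab x)] + lower x)%N.
Proof.
rewrite /cell_rank /cells_in /lower -cardsUI [X in (_ = _ + X)%N](_ : _ = 0%N).
  rewrite addn0; apply: eq_card => y; rewrite !finset.in_set.
  apply/idP/orP => [yx|[/set_mem /= yx|/andP[]//]].
    have [yxl|yxl] := key_top D yx; first by right; rewrite yxl eqxx.
    by left; apply/mem_set.
  rewrite ltnNge leq_eqVlt; apply/negP => /orP[/eqP/(key_inj D) xy|/(key_top D)[xy|xy]].
  - by apply: (@left_top_irr Pi (lab x)); rewrite {1}xy.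
  - by apply: (@left_top_irr Pi (lab x)); rewrite {1}xy.
  - exact: left_top_irr (left_top_trans xy yx).
apply/eqP; rewrite cards_eq0; apply/eqP/setP => y; rewrite !finset.in_set.
apply/negP => /andP[/set_mem /= yx /andP[/eqP yxl _]].
by apply: (@left_top_irr Pi (lab x)); rewrite -{1}yxl.
Qed.

Let lower_lt x : (lower x < cells_in [set lab x])%N.
Proof.
apply: proper_card; apply/fintype.properP; split.
  apply/fintype.subsetP => y; rewrite !finset.in_set => /andP[/eqP yx _].
  by apply/mem_set.
exists x; rewrite !finset.in_set ?ltnn ?andbF//.
by apply/mem_set.
Qed.

Lemma cell_rank_top x : let U := cells_in [set b | left_top Pi b (lab x)] in
  (U <= cell_rank x < U + cells_in [set lab x])%N.
Proof. by rewrite /= rank_split leq_addr ltn_add2l lower_lt. Qed.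

Lemma cell_rank_sigma x :
  (cell_rank (sigma x) + cells_in [set b | left_top Pi b (lab x)] =
   cell_rank x + cells_in [set b | left_bot Pi b (lab x)])%N.
Proof.
have -> : cell_rank (sigma x) =
    (cells_in [set b | left_bot Pi b (lab x)] + lower x)%N.
  rewrite /cell_rank -(on_card_preimset (f := sigma)); last first.
    by apply: onW_bij; apply: injF_bij; exact: sigma_inj D.
  rewrite /cells_in /lower -cardsUI [X in (_ = _ + X)%N](_ : _ = 0%N).
    rewrite addn0; apply: eq_card => y; rewrite !finset.in_set.
    apply/idP/orP => [yx|[/set_mem /= yx|/andP[/eqP yxl yx]]].
    - have [yxl|yxl] := key_bot D yx; last by left; apply/mem_set.
      right; rewrite yxl eqxx /= ltnNge leq_eqVlt; apply/negP.
      move=> /orP[/eqP/(key_inj D) xy|xy]; first by rewrite xy ltnn in yx.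
      by have := key_lab D (esym yxl) xy; rewrite ltnNge (ltnW yx).
    - rewrite ltnNge leq_eqVlt.
      apply/negP => /orP[/eqP/(key_inj D)/(sigma_inj D) xy|/(key_bot D)[xy|xy]].
      + by apply: (@left_bot_irr Pi (lab x)); rewrite {1}xy.
      + by apply: (@left_bot_irr Pi (lab x)); rewrite {1}xy.
      + exact: left_bot_irr (left_bot_trans xy yx).
    - rewrite ?finset.in_set; exact: (key_lab D yxl yx).
  apply/eqP; rewrite cards_eq0; apply/eqP/setP => y; rewrite !finset.in_set.
  apply/negP => /andP[/set_mem /= yx /andP[/eqP yxl _]].
  by apply: (@left_bot_irr Pi (lab x)); rewrite -{1}yxl.
by rewrite rank_split -addnA addnC [(lower x + _)%N]addnC.
Qed.

Lemma cell_rank_letter x a : let U := cells_in [set b | left_top Pi b a] in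
  (U <= cell_rank x < U + cells_in [set a])%N -> lab x = a.
Proof.
move=> /= /andP[ux xu]; have /andP[ux' xu'] := cell_rank_top x.
have mono b c : left_top Pi b c ->
    (cells_in [set d | left_top Pi d b] + cells_in [set b] <=
     cells_in [set d | left_top Pi d c])%N.
  move=> bc; rewrite -cells_in_addr; last exact: left_top_irr.
  apply: cells_in_mono => d [/= db|->//]; exact: left_top_trans bc.
have [//|/mono|/mono] := left_top_total Pi (lab x) a; lia.
Qed.

End cell_rank.

Lemma sum_fiber_set (R : realType) (T : finType) (f : T -> nat) (v : T -> R)
    (N : nat) (A : set nat) : (forall y, (f y < N)%N) ->
  \sum_(i < N | (i : nat) \in A) \sum_(y | f y == i) v y =
  \sum_(y | f y \in A) v y.
Proof.
move=> fN; rewrite [RHS](partition_big (fun y => Ordinal (fN y))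
  (fun i : 'I_N => (i : nat) \in A))//=.
apply: eq_bigr => i iA; apply: eq_bigl => y.
rewrite -val_eqE /=; have [->|_] := eqVneq (f y) i; last by rewrite andbF.
by rewrite iA.
Qed.

Section near_model.
Variables (R : realType) (Pi : grouped_permutation) (lam : simplex R).
Variables (X : finType) (key lab : X -> nat) (sigma : X -> X).
Hypothesis D : discrete_iet Pi key lab sigma.
Variables (rep : groups Pi -> nat) (t : groups Pi -> int) (N0 : nat).
Hypothesis lab_lt : forall x, (lab x < N0)%N.
Hypothesis rep_lt : forall g, (rep g < N0)%N.
Hypothesis drift : forall a, 1 <= \sum_(g | `[< left_top Pi (rep g) a >]) t g
                                - \sum_(g | `[< left_bot Pi (rep g) a >]) t g.
Variables (omega s : R).
Hypotheses (omega_gt0 : 0 < omega) (s_gt0 : 0 < s).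

Definition weight_at (i : nat) : R := \sum_(g | rep g == i) (t g)%:~R.

(** The vector [omega * c + s * tau], the weight of a whole group being carried by its
    representative letter. *)
Definition model_len (i : nat) : R :=
  omega * (cells_in lab [set i])%:R + s * weight_at i.

Hypothesis near_len : forall N, \sum_(i < N) `|lam i - model_len i| <= s / 8.

Definition drift_bound : nat := \sum_g `|t g|%N.
Local Notation K := (drift_bound%:R : R).

Definition weight_in (A : set nat) : R := \sum_(g | rep g \in A) (t g)%:~R.

Lemma weight_in_bound A : `|weight_in A| <= K.
Proof.
apply: le_trans (ler_norm_sum _ _ _) _.
rewrite /drift_bound natr_sum [leLHS]big_mkcond /=; apply: ler_sum => g _.
by case: ifP => _; rewrite ?ler0n// natr_absz intr_norm.
Qed.

Lemma cells_in_sum A : (cells_in lab A)%:R = \sum_(x | lab x \in A) (1 : R).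
Proof.
rewrite /cells_in -sum1_card natr_sum; apply: eq_bigl => x.
by rewrite finset.in_set.
Qed.

Lemma weight_atE i : weight_at i = weight_in [set i].
Proof.
by apply: eq_bigl => g; apply/eqP/idP => [->|/set_mem//]; apply/mem_set.
Qed.

Lemma model_len_eq0 i : (N0 <= i)%N -> model_len i = 0.
Proof.
move=> Ni; rewrite /model_len /weight_at big_pred0; last first.
  by move=> g; apply/negbTE; rewrite neq_ltn (leq_trans (rep_lt g)).
rewrite cells_in_sum big_pred0 ?mulr0 ?addr0// => x.
apply/negbTE/negP => /set_mem /= xi.
by have := lab_lt x; rewrite xi ltnNge Ni.
Qed.

Lemma sum_model_len A : \sum_(i < N0 | (i : nat) \in A) model_len i =
  omega * (cells_in lab A)%:R + s * weight_in A.
Proof.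
rewrite big_split /= -!mulr_sumr cells_in_sum /weight_in.
rewrite -(sum_fiber_set _ _ rep_lt) -(sum_fiber_set _ _ lab_lt).
congr (omega * _ + _); apply: eq_bigr => i _.
by rewrite cells_in_sum; apply: eq_bigl => x;
  apply/idP/eqP => [/set_mem|->//]; last exact/mem_set.
Qed.

Lemma letter_sum_model A :
  `|letter_sum lam A - (omega * (cells_in lab A)%:R + s * weight_in A)| <= s / 8.
Proof.
by rewrite -sum_model_len; apply: letter_sum_approx => //; exact: model_len_eq0.
Qed.

Lemma total_model : `|1 - omega * #|X|%:R| <= s * (K + 8^-1).
Proof.
have letterT : letter_sum lam setT = 1.
  apply/eqP; rewrite eq_le letter_sum_le1 /=; apply/ler_addgt0Pr => e e0.
  have [N /(_ N (leqnn _)) tail] := simplex_tail lam e0.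
  have := letter_sum_ge lam setT N.
  rewrite (eq_bigl xpredT); last by move=> i; rewrite in_setT.
  by lra.
have := letter_sum_model setT; rewrite letterT.
have -> : cells_in lab setT = #|X|.
  by rewrite -cardsT; apply: eq_card => x; rewrite !finset.in_set in_setT.
have := weight_in_bound setT; rewrite !ler_norml => /andP[w1 w2] /andP[? ?].
have : s * weight_in setT <= s * K by rewrite ler_pM2l.
have : - (s * K) <= s * weight_in setT by rewrite -mulrN ler_pM2l.
by rewrite mulrDr; move=> ? ?; apply/andP; split; lra.
Qed.

Definition top_cells a := cells_in lab [set b | left_top Pi b a].
Definition bot_cells a := cells_in lab [set b | left_bot Pi b a].

(** The two letter sums in a displacement are each known up to [s / 8], so [g] differs by at most
    1/4 from the difference of weights, which is at least 1 by [drift] and at most [2 * K]. *)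
Lemma iet_step a x : top_itv Pi lam a x -> exists2 g : R,
  2^-1 <= g <= 2 * K + 1 &
  iet Pi lam x = x + omega * ((bot_cells a)%:R - (top_cells a)%:R) - s * g.
Proof.
move=> ax; rewrite (ietE ax).
have topE := letter_sum_model [set b | left_top Pi b a].
have botE := letter_sum_model [set b | left_bot Pi b a].
rewrite -[letter_sum _ _]/(top_left Pi lam a) in topE.
rewrite -[letter_sum _ _]/(bot_left Pi lam a) in botE.
rewrite -/(top_cells a) in topE; rewrite -/(bot_cells a) in botE.
set wt := weight_in _ in topE; set wb := weight_in _ in botE.
have wd : 1 <= wt - wb.
  have := drift a; rewrite -(ler_int R) rmorphB /= !rmorph_sum /=.
  by rewrite /wt /wb /weight_in.
have := weight_in_bound [set b | left_top Pi b a]; rewrite -/wt => wtK.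
have := weight_in_bound [set b | left_bot Pi b a]; rewrite -/wb => wbK.
pose e := bot_left Pi lam a - top_left Pi lam a
          - omega * ((bot_cells a)%:R - (top_cells a)%:R) + s * (wt - wb).
have eb : `|e| <= s / 4.
  move: topE botE; rewrite /e !ler_norml => /andP[? ?] /andP[? ?].
  by apply/andP; split; lra.
exists (wt - wb - e / s).
  have : `|e / s| <= 4^-1.
    by rewrite normrM normfV (gtr0_norm s_gt0) ler_pdivrMr// mulrC.
  move: wtK wbK; rewrite !ler_norml => /andP[? ?] /andP[? ?] /andP[? ?].
  by apply/andP; split; lra.
have se : s * (e / s) = e by rewrite mulrCA divff ?mulr1 ?gt_eqF.
rewrite [s * (_ - e / s)]mulrBr se /e; lra.
Qed.

(** The ends of a top interval are within [s * (K + 1)] of multiples of [omega], so a point deeper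
    than this inside the cell [y] belongs to the letter of [y], whose displacement in cells is that
    of [sigma]. *)
Lemma iet_good_step a x y : top_itv Pi lam a x ->
  omega * (cell_rank key y)%:R + s * (K + 1) <= x <=
    omega * (cell_rank key y).+1%:R - s * (K + 1) ->
  exists2 g : R, 2^-1 <= g <= 2 * K + 1 &
  iet Pi lam x =
    x + omega * ((cell_rank key (sigma y))%:R - (cell_rank key y)%:R) - s * g.
Proof.
move=> ax /andP[yx xy]; have [g gb ->] := iet_step ax.
exists g => //; congr (_ + omega * _ - _).
suff ya : lab y = a.
  have := cell_rank_sigma D y; rewrite ya => /(congr1 (fun n => n%:R : R)).
  by rewrite !natrD -/(top_cells a) -/(bot_cells a); lra.
have topE := letter_sum_model [set b | left_top Pi b a].
rewrite -[letter_sum _ _]/(top_left Pi lam a) -/(top_cells a) in topE.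
have rightE := letter_sum_model ([set b | left_top Pi b a] `|` [set a]).
rewrite cells_in_addr in rightE; last exact: left_top_irr.
rewrite -/(top_cells a) in rightE.
have right_le : top_left Pi lam a + lam a <=
    letter_sum lam ([set b | left_top Pi b a] `|` [set a]).
  by apply: letter_sum_add; [left|right|exact: left_top_irr].
set w1 := weight_in _ in topE; set w2 := weight_in _ in rightE.
have := weight_in_bound [set b | left_top Pi b a]; rewrite -/w1 => w1K.
have := weight_in_bound ([set b | left_top Pi b a] `|` [set a]); rewrite -/w2 => w2K.
have sw1 : `|s * w1| <= s * K by rewrite normrM (gtr0_norm s_gt0) ler_pM2l.
have sw2 : `|s * w2| <= s * K by rewrite normrM (gtr0_norm s_gt0) ler_pM2l.
move: topE rightE sw1 sw2 ax; rewrite /top_itv /= in_itv /=.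
rewrite !ler_norml => /andP[? ?] /andP[? ?] /andP[? ?] /andP[? ?] /andP[? ?].
rewrite mulrDr mulr1 in yx xy.
apply: (cell_rank_letter D); rewrite -/(top_cells a).
apply/andP; split.
  rewrite -ltnS -(ltr_nat R) -(ltr_pM2l omega_gt0); lra.
rewrite -(ltr_nat R) -(ltr_pM2l omega_gt0); lra.
Qed.

End near_model.

(** * Orbits with a one-sided drift modulo the cell width *)

Section drifting_orbits.
Variables (R : realType) (X : finType) (rk : X -> nat) (sigma : X -> X).
Variables (omega s : R) (L C : nat) (f : R -> R) (dom : set R).
Hypotheses (omega_gt0 : 0 < omega) (s_gt0 : 0 < s) (L_gt0 : (0 < L)%N).
Hypothesis step : forall x, dom x -> exists (z : int) (g : R),
  2^-1 <= g <= C%:R /\ f x = x + omega * z%:~R - s * g.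
Hypothesis good_step : forall x y, dom x ->
  omega * (rk y)%:R + s * L%:R <= x <= omega * (rk y).+1%:R - s * L%:R ->
  exists g : R, 2^-1 <= g <= C%:R /\
    f x = x + omega * ((rk (sigma y))%:R - (rk y)%:R) - s * g.

Definition full_orbit : set R := [set x | forall k, dom (iter k f x)].

Lemma iter_shift n x : full_orbit x -> exists (z : int) (g : R),
  n%:R / 2 <= g <= n%:R * C%:R /\ iter n f x = x + omega * z%:~R - s * g.
Proof.
move=> xD; elim: n => [|n [z [g [/andP[g1 g2] fg]]]].
  by exists 0, 0; rewrite !mul0r lexx !mulr0 subr0 addr0.
have [z' [g' [/andP[g1' g2'] fg']]] := step (xD n).
exists (z + z'), (g + g'); split.
  by rewrite -natr1 !mulrDl !mul1r; apply/andP; split; lra.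
by rewrite iterS fg' fg rmorphD /=; lra.
Qed.

(** As the drift only goes to the left, the margin on the right can stay at [L], while the one on
    the left has to absorb the drift of up to [#|X|] steps. *)
Lemma iter_good n x y : (n <= #|X|)%N -> full_orbit x ->
  omega * (rk y)%:R + s * (L + #|X| * C)%:R <= x <=
    omega * (rk y).+1%:R - s * L%:R ->
  exists g : R, 0 <= g <= n%:R * C%:R /\
    iter n f x = x + omega * ((rk (iter n sigma y))%:R - (rk y)%:R) - s * g.
Proof.
move=> + xD xy; elim: n => [|n IHn] nX.
  by exists 0; rewrite !mul0r lexx subrr !mulr0 subr0 addr0.
have [g [/andP[g1 g2] fg]] := IHn (ltnW nX).
have gX : g <= (#|X| * C)%:R.
  by apply: le_trans g2 _; rewrite -natrM ler_nat leq_mul2r ltnW ?orbT.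
have sg0 : 0 <= s * g by rewrite mulr_ge0// ltW.
have sgX : s * g <= s * (#|X| * C)%:R by rewrite ler_pM2l.
have [|g' [/andP[g1' g2'] fg']] := @good_step (iter n f x) (iter n sigma y) (xD n).
  rewrite fg; move: xy; rewrite natrD mulrDr -!natr1 !mulrDr !mulr1.
  by move=> /andP[? ?]; apply/andP; split; lra.
exists (g + g'); split.
  by rewrite -natr1 !mulrDl !mul1r; apply/andP; split; lra.
by rewrite !iterS fg' fg; lra.
Qed.

(** In units of [s]: the margin of [good_step] plus the largest drift during one turn of [sigma]. *)
Definition bad_radius := (L + #|X| * C)%N.

Definition near_grid : set R :=
  \bigcup_n `](omega * n%:R - s * bad_radius%:R),
             (omega * n%:R + s * bad_radius%:R)[%classic.

(* Between two of these times the drift modulo omega exceeds the width of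
   near_grid, but is too small for a return from the other side. *)
Lemma near_grid_recurrence J x : full_orbit x ->
  s * (J * (4 * bad_radius) * C + 2 * bad_radius)%:R <= omega ->
  \sum_(i < J) (\1_near_grid (iter (i * (4 * bad_radius)) f x) : R) <= 1.
Proof.
set M := bad_radius; move=> xD small.
have no_return i j : (i < j < J)%N -> near_grid (iter (i * (4 * M)) f x) ->
    ~ near_grid (iter (j * (4 * M)) f x).
  move=> /andP[ij jJ] [k _ /=]; rewrite in_itv /= => ki [l _ /=].
  rewrite in_itv /= => lj.
  have xD' : full_orbit (iter (i * (4 * M)) f x).
    by move=> u; rewrite -iterD; apply: xD.
  have [z [g [/andP[g1 g2] fg]]] := iter_shift ((j - i) * (4 * M)) xD'.
  rewrite -iterD -mulnDl subnK ?(ltnW ij)// in fg.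
  have lo : s * (2 * M)%:R <= s * g.
    rewrite ler_pM2l// (le_trans _ g1)// ler_pdivlMr// -natrM ler_nat.
    have : (1 * (4 * M) <= (j - i) * (4 * M))%N by rewrite leq_mul2r subn_gt0 ij orbT.
    by clear; lia.
  have hi : s * g <= omega - s * (2 * M)%:R.
    rewrite lerBrDr -mulrDr (le_trans _ small)// ler_pM2l// natrD lerD2r.
    rewrite (le_trans g2)// -natrM ler_nat leq_mul2r leq_mul2r; apply/orP; right.
    by apply/orP; right; clear - jJ; lia.
  move: ki lj; rewrite fg natrM in lo hi * => /andP[? ?] /andP[? ?].
  (* By [lo] and [hi] this multiple of [omega] lies strictly between [- omega] and 0, which is
     absurd. *)
  have : omega * (l%:Z - k%:Z - z)%:~R < 0.
    by rewrite !rmorphB /= -!pmulrn; lra.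
  rewrite pmulr_rlt0// ltrz0 => zneg.
  have : omega * (l%:Z - k%:Z - z)%:~R <= omega * (-1)%:~R.
    by rewrite ler_pM2l// ler_int; clear - zneg; lia.
  by rewrite !rmorphB /= -!pmulrn; lra.
have [[i iM]|none] := pselect (exists i : 'I_J, near_grid (iter (i * (4 * M)) f x)).
  rewrite (bigD1 i)//= big1 ?addr0; first by rewrite indicE; case: (_ \in _).
  move=> j ji; rewrite indicE memNset//.
  move: ji; rewrite -val_eqE neq_ltn => /orP[ji jM|ij].
    by apply: (no_return j i _ jM iM); rewrite ji ltn_ord.
  by apply: (no_return i j _ iM); rewrite ij ltn_ord.
rewrite big1// => i _; rewrite indicE memNset// => iM; apply: none; by exists i.
Qed.

Hypothesis rk_surj : forall n, (n < #|X|)%N -> exists y, rk y = n.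
Hypothesis dom01 : dom `<=` `[0, 1]%classic.
Hypothesis total : 1 < omega * #|X|%:R + s * L%:R.

Lemma off_grid_cell x : dom x -> ~ near_grid x -> exists y,
  omega * (rk y)%:R + s * bad_radius%:R <= x <=
    omega * (rk y).+1%:R - s * bad_radius%:R.
Proof.
move=> /dom01; rewrite /= in_itv /= => /andP[x0 x1] xM.
have sM : 0 < s * bad_radius%:R by rewrite mulr_gt0// ltr0n addn_gt0 L_gt0.
pose n := Num.truncn (x / omega).
have /andP[n1 n2] : (n%:R : R) <= x / omega < n.+1%:R.
  by apply: truncn_itv; rewrite divr_ge0// ltW.
rewrite ler_pdivlMr// mulrC in n1; rewrite ltr_pdivrMr// mulrC in n2.
have lo : omega * n%:R + s * bad_radius%:R <= x.
  rewrite leNgt; apply/negP => lt; apply: xM; exists n => //=.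
  by rewrite in_itv /=; apply/andP; split; lra.
have hi : x <= omega * n.+1%:R - s * bad_radius%:R.
  rewrite leNgt; apply/negP => lt; apply: xM; exists n.+1 => //=.
  by rewrite in_itv /=; apply/andP; split; lra.
(* By [total], a point of [0, 1] beyond the last cell would be near the grid. *)
have [|y yn] := rk_surj (n := n); last by exists y; rewrite yn lo hi.
rewrite ltnNge; apply/negP => Xn.
have : omega * #|X|%:R <= omega * n%:R by rewrite ler_pM2l// ler_nat.
have : s * L%:R <= s * bad_radius%:R by rewrite ler_pM2l// ler_nat leq_addr.
by have := total; lra.
Qed.

Hypothesis rk_bij : forall n, (n <= #|X|)%N -> #|[set y | (rk y < n)%N]%SET| = n.
Hypothesis sigma_inj : injective sigma.
Hypothesis single_orbit : forall x y, fconnect sigma x y.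

Lemma order_single y : order sigma y = #|X|.
Proof. by apply: eq_card => z; rewrite inE; exact: single_orbit. Qed.

Lemma sum_single_orbit (F : X -> R) y :
  \sum_(k < #|X|) F (iter k sigma y) = \sum_x F x.
Proof.
have orbitP : perm_eq (orbit sigma y) (enum X).
  apply: uniq_perm; [exact: orbit_uniq|exact: enum_uniq|].
  by move=> z; rewrite mem_enum -fconnect_orbit single_orbit.
rewrite -[RHS]big_enum -(perm_big _ orbitP) /= /orbit order_single.
rewrite (big_nth y) size_traject big_mkord.
by apply: eq_bigr => k _; rewrite nth_traject.
Qed.

(** Starting off the grid, the orbit follows [sigma] for a whole turn and visits each cell once;
    exactly [m] cells lie below [omega * m], and the margins prevent any point from straying across
    this value. *)
Lemma sum_below_grid x m : full_orbit x -> ~ near_grid x -> (m <= #|X|)%N ->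
  \sum_(k < #|X|) (\1_`]-oo, (omega * m%:R)[%classic (iter k f x) : R) = m%:R.
Proof.
move=> xD xM mX; have [y xy] := off_grid_cell (xD 0%N : dom x) xM.
have sL : 0 < s * L%:R by rewrite mulr_gt0// ltr0n.
have LM : s * L%:R <= s * bad_radius%:R by rewrite ler_pM2l// ler_nat leq_addr.
transitivity (\sum_(k < #|X|) ((rk (iter k sigma y) < m)%N%:R : R)).
  apply: eq_bigr => k _; rewrite indicE; congr (_ %:R).
  have [|g [/andP[g0 gk] ->]] := @iter_good k x y (ltnW (ltn_ord k)) xD.
    move: xy => /andP[? ?]; apply/andP; split; first by [].
    by move: LM; lra.
  have sg0 : 0 <= s * g by rewrite mulr_ge0// ltW.
  have sgX : s * g <= s * (#|X| * C)%:R.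
    rewrite ler_pM2l// (le_trans gk)// -natrM ler_nat leq_mul2r.
    by rewrite (ltnW (ltn_ord k)) orbT.
  move: xy; rewrite /bad_radius natrD mulrDr -natr1 mulrDr mulr1 => /andP[? ?].
  congr nat_of_bool; apply/idP/idP => [/set_mem /=|rm].
    rewrite in_itv /= => lt; rewrite -(ltr_nat R) -(ltr_pM2l omega_gt0).
    by move: sL; lra.
  apply/mem_set; rewrite /= in_itv /=.
  have : omega * (rk (iter k sigma y)).+1%:R <= omega * m%:R.
    by rewrite ler_pM2l// ler_nat.
  by rewrite -natr1 mulrDr mulr1; move: sL; lra.
rewrite (sum_single_orbit (fun z => (rk z < m)%N%:R)) -[RHS](congr1 _ (rk_bij mX)).
rewrite -sum1_card natr_sum [RHS]big_mkcond /=; apply: eq_bigr => z _.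
by rewrite finset.in_set; case: ifP.
Qed.

End drifting_orbits.

(** * Averages of an invariant measure along orbits *)

Section invariant_measure.
Variables (R : realType) (f : R -> R) (dom : set R).
Variable nu : probability (measurableTypeR R) R.
Implicit Types A E F : set (measurableTypeR R).
Hypothesis mf : forall A, measurable A -> measurable (f @^-1` A : set (measurableTypeR R)).
Hypothesis nuf : forall A, measurable A -> nu (f @^-1` A) = nu A.
Hypothesis mdom : measurable (dom : set (measurableTypeR R)).
Hypothesis nudom : nu dom = 1%E.

Lemma measurable_iter_preimage k A : measurable A ->
  measurable (iter k f @^-1` A : set (measurableTypeR R)).
Proof.
by elim: k A => [//|k IHk] A mA; apply: (IHk (f @^-1` A)); exact: mf.
Qed.

Lemma invariant_iter k A : measurable A -> nu (iter k f @^-1` A) = nu A.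
Proof.
elim: k A => [//|k IHk] A mA; rewrite -[RHS]nuf// -(IHk (f @^-1` A))//.
exact: mf.
Qed.

Let nu_setC0 A : measurable A -> nu A = 1%E -> nu (~` A) = 0%E.
Proof. by move=> mA nuA; rewrite probability_setC// nuA subee. Qed.

Lemma full_orbitE : full_orbit f dom = \bigcap_k (iter k f @^-1` dom).
Proof. by apply/seteqP; split=> x xD k => [_|]; exact: (xD k). Qed.

Lemma measurable_full_orbit : measurable (full_orbit f dom : set (measurableTypeR R)).
Proof.
rewrite full_orbitE; apply: bigcap_measurable; first by exists 0%N.
move=> k _.
exact: measurable_iter_preimage.
Qed.

Lemma full_orbit1 : nu (full_orbit f dom) = 1%E.
Proof.
have mD := measurable_full_orbit.
have nuC : nu (~` full_orbit f dom) = 0%E.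
  apply: measure_negligible; first exact: measurableC.
  rewrite full_orbitE setC_bigcap; apply: negligible_bigcup => k.
  apply/negligibleP; first by apply: measurableC; exact: measurable_iter_preimage.
  have mk := measurable_iter_preimage k mdom.
  by apply: (nu_setC0 mk); rewrite invariant_iter.
move: nuC; rewrite probability_setC// => nuC.
rewrite -[LHS]adde0 -nuC addeCA subee ?adde0// fin_num_measure//.
Qed.

Lemma full_orbitI A : measurable A -> nu (A `&` full_orbit f dom) = nu A.
Proof.
move=> mA; have mD := measurable_full_orbit.
have nuC : nu (~` full_orbit f dom) = 0%E.
  by apply: nu_setC0 => //; exact: full_orbit1.
rewrite -[in RHS](setIT A) -(setUv (full_orbit f dom)) setIUr measureU//.
- rewrite [X in (_ + X)%E](_ : _ = 0%E) ?adde0//.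
  apply/eqP; rewrite eq_le measure_ge0 andbT -nuC le_measure ?inE//.
  + by apply: measurableI => //; exact: measurableC.
  + exact: measurableC.
- exact: measurableI.
- by apply: measurableI => //; exact: measurableC.
- by rewrite setIACA setICr setI0.
Qed.

(** The pointwise bound is integrated over the full orbits, a set of measure 1; by invariance each
    term on the left contributes [nu E]. The times [tau] are free in order to cover both the sparse
    times of [near_grid_recurrence] and the consecutive ones of a turn. *)
Lemma orbit_average n (tau : nat -> nat) E F (a b : R) :
  measurable E -> measurable F -> 0 <= a -> 0 <= b ->
  (forall x, full_orbit f dom x ->
     \sum_(i < n) (\1_E (iter (tau i) f x) : R) <= a + b * \1_F x) ->
  n%:R * fine (nu E) <= a + b * fine (nu F).
Proof.
move=> mE mF a0 b0 le_ab; have mD := measurable_full_orbit.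
pose D : set (measurableTypeR R) := full_orbit f dom.
pose h (i : 'I_n) (x : measurableTypeR R) : \bar R :=
  (\1_(iter (tau i) f @^-1` E : set (measurableTypeR R)) x)%:E.
have mh (i : 'I_n) : measurable_fun D (h i).
  apply/measurable_EFinP; apply: measurable_indic.
  exact: measurable_iter_preimage.
have lhs : (\int[nu]_(x in D) (\sum_(i < n) h i x) = (n%:R * fine (nu E))%:E)%E.
  rewrite ge0_integral_sum//; last by move=> i x _; rewrite lee_fin indicE ler0n.
  rewrite (eq_bigr (fun=> (fine (nu E))%:E)); last first.
    move=> i _; have mi := measurable_iter_preimage (tau i) mE.
    rewrite integral_indic//; apply: (etrans (full_orbitI mi)).
    by rewrite fineK ?fin_num_measure// invariant_iter.
  by rewrite sumEFin sumr_const card_ord mulr_natl.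
have rhs : (\int[nu]_(x in D) (a%:E + b%:E * (\1_F x)%:E) = (a + b * fine (nu F))%:E)%E.
  have mF1 : measurable_fun D (fun x : measurableTypeR R => (\1_F x : R)%:E).
    by apply/measurable_EFinP; exact: measurable_indic.
  have F0 (x : measurableTypeR R) : (0 <= (\1_F x : R)%:E)%E by rewrite lee_fin indicE ler0n.
  rewrite ge0_integralD//; last 2 first.
  - by move=> x _; rewrite mule_ge0// lee_fin.
  - by apply: measurable_funeM.
  have -> : (\int[nu]_(x in D) a%:E = a%:E)%E.
    rewrite integral_cst//; apply: (etrans (congr1 (mule a%:E) full_orbit1)).
    by rewrite mule1.
  rewrite ge0_integralZl_EFin// integral_indic// EFinD EFinM; congr (_ + _ * _)%E.
  by apply: (etrans (full_orbitI mF)); rewrite fineK// fin_num_measure.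
rewrite -lee_fin -lhs -rhs; apply: ge0_le_integral => //.
- by move=> x _; apply: sume_ge0 => i _; rewrite lee_fin indicE ler0n.
- exact: emeasurable_sum.
- apply: emeasurable_funD => //; apply: measurable_funeM.
  by apply/measurable_EFinP; exact: measurable_indic.
move=> x Dx; rewrite sumEFin -EFinM -EFinD lee_fin.
apply: le_trans (le_ab x Dx); rewrite le_eqVlt; apply/orP; left; apply/eqP.
by apply: eq_bigr => i _; rewrite /= !indicE.
Qed.

End invariant_measure.

(** * Distribution functions of the invariant measures *)

Section equidistribution.
Variables (R : realType) (Pi : grouped_permutation) (lam : simplex R).
Variables (X : finType) (key lab : X -> nat) (sigma : X -> X).
Hypothesis D : discrete_iet Pi key lab sigma.
Hypothesis single_orbit : forall x y, fconnect sigma x y.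
Variables (rep : groups Pi -> nat) (t : groups Pi -> int) (N0 : nat).
Hypothesis lab_lt : forall x, (lab x < N0)%N.
Hypothesis rep_lt : forall g, (rep g < N0)%N.
Hypothesis drift : forall a, 1 <= \sum_(g | `[< left_top Pi (rep g) a >]) t g
                                - \sum_(g | `[< left_bot Pi (rep g) a >]) t g.
Variables (omega s : R).
Hypotheses (omega_gt0 : 0 < omega) (s_gt0 : 0 < s).
Hypothesis near_len :
  forall N, \sum_(i < N) `|lam i - model_len lab rep t omega s i| <= s / 8.

(** With [max_drift], the constants of [iet_good_step] and [iet_step] as natural numbers. *)
Definition margin := (drift_bound t).+1.
Definition max_drift := (drift_bound t).*2.+1.
Local Notation L := margin.
Local Notation C := max_drift.
Local Notation B := (bad_radius X L C).
Local Notation T := (iet Pi lam).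
Local Notation dom := (iet_dom Pi lam).
Local Notation Q := #|X|.

Let CE : C%:R = 2 * (drift_bound t)%:R + 1 :> R.
Proof. by rewrite /max_drift -natr1 -mul2n natrM. Qed.

Let LE : L%:R = (drift_bound t)%:R + 1 :> R.
Proof. by rewrite /margin -natr1. Qed.

Let step x : dom x -> exists (z : int) (g : R),
  2^-1 <= g <= C%:R /\ T x = x + omega * z%:~R - s * g.
Proof.
move=> [a _ ax]; have [g gb ->] := iet_step lab_lt rep_lt drift s_gt0 near_len ax.
exists ((bot_cells Pi lab a)%:Z - (top_cells Pi lab a)%:Z), g; split; first by rewrite CE.
by rewrite rmorphB /= -!pmulrn.
Qed.

Let good_step x y : dom x ->
  omega * (cell_rank key y)%:R + s * L%:R <= x <=
    omega * (cell_rank key y).+1%:R - s * L%:R ->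
  exists g : R, 2^-1 <= g <= C%:R /\
    T x = x + omega * ((cell_rank key (sigma y))%:R - (cell_rank key y)%:R) - s * g.
Proof.
move=> [a _ ax]; rewrite LE => xy.
have [g gb ->] := iet_good_step D lab_lt rep_lt drift omega_gt0 s_gt0 near_len ax xy.
by exists g; rewrite CE.
Qed.

Let total : 1 < omega * Q%:R + s * L%:R.
Proof.
have := total_model lab_lt rep_lt s_gt0 near_len; rewrite LE ler_norml => /andP[_].
by rewrite !mulrDr mulr1; have := s_gt0; lra.
Qed.

Let dom01 : dom `<=` `[0, 1]%classic.
Proof. by move=> x [a _ /(layout_sub01 (@left_top_irr Pi))]. Qed.

Let rk_surj n : (n < Q)%N -> exists y, cell_rank key y = n.
Proof. exact: (cell_rank_surj D). Qed.

Let rk_bij n : (n <= Q)%N -> #|[set y | (cell_rank key y < n)%N]%SET| = n.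
Proof.
move=> nQ; rewrite -[RHS](card_bij_prefix (cell_ord_bij D) nQ).
by apply: eq_card => y; rewrite !inE.
Qed.

Lemma measurable_near_grid :
  measurable (near_grid X omega s L C : set (measurableTypeR R)).
Proof. by apply: bigcup_measurable => n _; exact: measurable_itv. Qed.

Section measure.
Variable nu : probability (measurableTypeR R) R.
Hypothesis nuI : iet_invariant Pi lam nu.

Let nudom : nu dom = 1%E.
Proof.
(* The preimage of the whole line inside the domain is the domain, so invariance gives it full
   measure. *)
have := nuI.2 setT measurableT; rewrite preimage_setT setIT => ->.
exact: probability_setT.
Qed.

Let nuf (A : set (measurableTypeR R)) : measurable A -> nu (T @^-1` A) = nu A.
Proof.
move=> mA; rewrite -[RHS](nuI.2 A mA) setIC.
have mTA := measurable_iet_preimage Pi lam mA; have mD := measurable_iet_dom Pi lam.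
have nuC : nu (~` dom) = 0%E by rewrite probability_setC// nudom subee.
rewrite -[in LHS](setIT (T @^-1` A)) -(setUv dom) setIUr measureU//.
- rewrite [X in (_ + X)%E](_ : _ = 0%E) ?adde0//.
  apply/eqP; rewrite eq_le measure_ge0 andbT -nuC le_measure ?inE//.
  + by apply: measurableI => //; exact: measurableC.
  + exact: measurableC.
- exact: measurableI.
- by apply: measurableI => //; exact: measurableC.
- by rewrite setIACA setICr setI0.
Qed.

Let average := orbit_average (measurable_iet_preimage Pi lam) nuf
  (measurable_iet_dom Pi lam) nudom.

Lemma near_grid_measure J :
  s * (J * (4 * B) * C + 2 * B)%:R <= omega ->
  J%:R * fine (nu (near_grid X omega s L C)) <= 1.
Proof.
move=> small.
have := @average J (fun i => (i * (4 * B))%N) (near_grid X omega s L C) set0 1 0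
  measurable_near_grid measurable0 ler01 (lexx 0).
rewrite mul0r addr0; apply=> x xD; rewrite mul0r addr0.
exact: (near_grid_recurrence omega_gt0 s_gt0 step).
Qed.

(** A turn starting off the grid has exactly [m] points below [omega * m]; one starting near it has
    between 0 and [Q]. The lower bound is the upper one applied to the complement. *)
Lemma below_grid_measure m : (m <= Q)%N ->
  `|Q%:R * fine (nu `]-oo, (omega * m%:R)[%classic) - m%:R|
  <= Q%:R * fine (nu (near_grid X omega s L C)).
Proof.
move=> mQ; set G := near_grid X omega s L C.
pose E : set (measurableTypeR R) := `]-oo, (omega * m%:R)[%classic.
have mE : measurable E by exact: measurable_itv.
have ind01 (A : set R) (x : R) : 0 <= (\1_A x : R) <= 1.
  by rewrite indicE; case: (x \in A); rewrite /= ?lexx ler01.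
have Qsum : Q%:R = \sum_(i < Q) (1 : R) by rewrite sumr_const card_ord.
have sumE x : full_orbit T dom x -> ~ G x ->
    \sum_(k < Q) (\1_E (iter k T x) : R) = m%:R.
  move=> xD xG.
  exact: (sum_below_grid omega_gt0 s_gt0 _ good_step rk_surj dom01 total
    rk_bij single_orbit xD xG mQ).
have up : Q%:R * fine (nu E) <= m%:R + Q%:R * fine (nu G).
  apply: (@average Q id) => //; first exact: measurable_near_grid.
  move=> x xD; rewrite [\1_G x]indicE; have [/set_mem xG|/negP xG] := boolP (x \in G).
    rewrite mulr1 (@le_trans _ _ Q%:R) ?lerDr//.
    rewrite Qsum; apply: ler_sum => i _.
    by have /andP[] := ind01 E (iter i T x).
  by rewrite mulr0 addr0 sumE// => /mem_set.
have low : Q%:R * fine (nu (~` E)) <= (Q%:R - m%:R) + Q%:R * fine (nu G).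
  apply: (@average Q id) => //.
  - exact: measurableC.
  - exact: measurable_near_grid.
  - by rewrite subr_ge0 ler_nat.
  move=> x xD.
  have -> : \sum_(i < Q) (\1_(~` E) (iter i T x) : R) =
      Q%:R - \sum_(i < Q) (\1_E (iter i T x) : R).
    rewrite Qsum -sumrB; apply: eq_bigr => i _.
    by rewrite !indicE in_setC; case: (_ \in E); rewrite /= ?subrr ?subr0.
  rewrite [\1_G x]indicE; have [/set_mem xG|/negP xG] := boolP (x \in G).
    rewrite mulr1 (@le_trans _ _ Q%:R)//; last by rewrite lerDr subr_ge0 ler_nat.
    by rewrite gerBl sumr_ge0.
  by rewrite mulr0 addr0 sumE// => /mem_set.
move: low; rewrite probability_setC// fineB ?fin_num_measure// mulrBr mulr1 => low.
by rewrite ler_norml; apply/andP; split; lra.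
Qed.

End measure.

(** The three errors are the mass near the grid, the proportion of one cell, and the discrepancy
    between [omega * Q] and 1. *)
Lemma equidistributed_near J : (0 < J)%N ->
  s * (J * (4 * B) * C + 2 * B)%:R <= omega ->
  equidistributed Pi lam (J%:R^-1 + Q%:R^-1 + s * L%:R).
Proof.
move=> J0 small nu nuI a /andP[a0 a1].
have Q0 : (0 < Q)%N.
  have [g _] : exists g : groups Pi, g \in predT.
    by apply/card_gt0P; apply: leq_trans (card_groups_ge2 Pi).
  by have [x _] := lab_group D g; apply/card_gt0P; exists x.
have QR0 : (0 : R) < Q%:R by rewrite ltr0n.
set G := near_grid X omega s L C.
have nuG : fine (nu G) <= J%:R^-1.
  by rewrite -[leRHS]mul1r ler_pdivlMr ?ltr0n// mulrC; exact: near_grid_measure.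
pose F (b : R) := fine (nu `]-oo, b]%classic).
pose E m := fine (nu `]-oo, (omega * m%:R)[%classic).
have Ebound m : (m <= Q)%N -> `|E m - m%:R / Q%:R| <= J%:R^-1.
  move=> mQ; apply: le_trans nuG; rewrite -(ler_pM2l QR0).
  apply: le_trans (below_grid_measure nuI mQ).
  rewrite -{1}(gtr0_norm QR0) -normrM mulrBr.
  by rewrite [Q%:R * (_ / _)]mulrCA divff ?mulr1 ?gt_eqF.
have le_nu (A A' : set (measurableTypeR R)) : measurable A -> measurable A' ->
    A `<=` A' -> fine (nu A) <= fine (nu A').
  move=> mA mA' AA'; rewrite fine_le ?fin_num_measure//.
  by rewrite le_measure ?inE.
have EF m : omega * m%:R <= a -> E m <= F a.
  move=> ma; apply: le_nu; [exact: measurable_itv|exact: measurable_itv|].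
  by move=> x /=; rewrite !in_itv /= => /ltW xm; apply: le_trans ma.
have FE m : a < omega * m%:R -> F a <= E m.
  move=> ma; apply: le_nu; [exact: measurable_itv|exact: measurable_itv|].
  by move=> x /=; rewrite !in_itv /= => xa; apply: le_lt_trans ma.
have tot : `|1 - omega * Q%:R| <= s * L%:R.
  apply: le_trans (total_model lab_lt rep_lt s_gt0 near_len) _.
  by rewrite ler_pM2l// LE lerD2l; lra.
have near m : (m <= Q)%N -> `|omega * m%:R - m%:R / Q%:R| <= s * L%:R.
  move=> mQ; apply: le_trans tot.
  have -> : omega * m%:R - m%:R / Q%:R = (omega * Q%:R - 1) * (m%:R / Q%:R).
    rewrite mulrBl mul1r -mulrA; congr (_ * _ - _).
    by rewrite mulrCA divff ?mulr1 ?gt_eqF.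
  rewrite normrM distrC -[leRHS]mulr1 ler_wpM2l//.
  by rewrite ger0_norm ?divr_ge0// ler_pdivrMr// mul1r ler_nat.
have QV0 : (0 : R) < Q%:R^-1 by rewrite invr_gt0.
pose n := Num.truncn (a / omega).
have /andP[n1 n2] : (n%:R : R) <= a / omega < n.+1%:R.
  by apply: truncn_itv; rewrite divr_ge0// ltW.
rewrite ler_pdivlMr// mulrC in n1; rewrite ltr_pdivrMr// mulrC in n2.
have [nQ|Qn] := ltnP n Q.
  have := Ebound n (ltnW nQ); have := Ebound n.+1 nQ.
  have := near n (ltnW nQ); have := near n.+1 nQ.
  have := EF n n1; have := FE n.+1 n2; rewrite -!natr1 !mulrDl !mulrDr !mulr1 mul1r.
  rewrite !ler_norml => ? ? /andP[? ?] /andP[? ?] /andP[? ?] /andP[? ?].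
  by apply/andP; split; rewrite -/(F a); lra.
have Qa : omega * Q%:R <= a.
  by apply: le_trans n1; rewrite ler_pM2l// ler_nat.
have F1 : F a <= 1.
  by rewrite -lee_fin fineK ?fin_num_measure// probability_le1.
have := Ebound Q (leqnn Q); have := EF Q Qa; move: tot.
rewrite divff ?gt_eqF// !ler_norml => /andP[? ?] ? /andP[? ?].
by apply/andP; split; rewrite -/(F a); lra.
Qed.

End equidistribution.

(** * Density *)

Section density.
Variables (R : realType) (Pi : grouped_permutation).
Hypotheses (Pi_irr : is_irreducible Pi) (Pi_proper : is_proper Pi).

Lemma sum_dist_prefix (lam : simplex R) (l : nat -> R) N N' d e :
  (forall i, (i < N)%N -> `|lam i - l i| <= d) ->
  (forall i, (N <= i)%N -> l i = 0) -> 1 - e <= \sum_(i < N) lam i ->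
  \sum_(i < N') `|lam i - l i| <= d *+ N + e.
Proof.
move=> ld l0 tail.
apply: (@le_trans _ _ (\sum_(i < N' + N) `|lam i - l i|)).
  by rewrite big_split_ord /= lerDl sumr_ge0.
rewrite addnC big_split_ord /= lerD//.
  rewrite -[in leRHS](card_ord N) -sumr_const; apply: ler_sum => i _.
  exact: ld.
rewrite (eq_bigr (fun i : 'I_N' => lam (N + i)%N)); last first.
  by move=> i _; rewrite l0 ?leq_addr// subr0 gtr0_norm ?len_gt0.
have := simplex_partial lam (N + N'); rewrite big_split_ord /=; move: tail; lra.
Qed.

Lemma letter_of_group (g : groups Pi) : exists a, group_of Pi a = g.
Proof.
have [[a aE]|inf] := group_single_or_infinite g.
  by exists a; have : [set a] a by []; rewrite -aE.
by have [a ag] := infinite_setN0 inf; exists a.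
Qed.

Lemma count_approx (lam : simplex R) (d : R) (n0 : nat) : 0 < d ->
  exists (X : finType) (key lab : X -> nat) (sigma : X -> X) (w : R),
    [/\ discrete_iet Pi key lab sigma, 0 < w, (n0 <= #|X|)%N &
      forall N, \sum_(i < N) `|lam i - mass lab (fun=> w) i| <= d].
Proof.
move=> d0; have d2 : 0 < d / 2 by rewrite divr_gt0.
have [N1 tail] := simplex_tail lam d2.
have /choice [a0 a0E] := letter_of_group.
(* Enough letters to leave a small tail, to provide [n0] cells, and to include a letter of every
   group. *)
pose N := (N1 + n0 + \sum_g (a0 g).+1)%N.
have a0N g : (a0 g < N)%N.
  by rewrite /N (bigD1 g)//= addnCA addSn ltnS leq_addr.
pose M := (Num.truncn (N%:R / (d / 2))).+1.
have M0 : (0 : R) < M%:R by rewrite ltr0n.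
have NM : N%:R / M%:R <= d / 2 :> R.
  rewrite ler_pdivrMr// mulrC -ler_pdivrMr// ltW//; exact: truncnS_gt.
(* The successor gives each letter below [N] at least one cell, and the error remains at most
   [M%:R^-1] per letter. *)
pose c i := (Num.truncn (M%:R * lam i)).+1.
have [|X [key [lab [sigma [D labc]]]]] := @discrete_iet_of_counts Pi N c.
  by move=> g; exists (a0 g).
have massE i : mass lab (fun=> M%:R^-1) i = (if (i < N)%N then c i else 0%N)%:R / M%:R :> R.
  by rewrite /mass sumr_const -labc cardsE mulr_natl.
exists X, key, lab, sigma, M%:R^-1; split=> //.
- by rewrite invr_gt0.
- apply: (@leq_trans N); first by rewrite /N addnAC leq_addl.
  have /choice [f fE] : forall i : 'I_N, exists x, lab x = i.
    move=> i; have : (0 < #|[set x | lab x == i]%SET|)%N by rewrite labc ltn_ord.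
    by move=> /card_gt0P [x]; rewrite inE => /eqP; exists x.
  rewrite -[N]card_ord; apply: (@leq_card _ _ f) => i j ij.
  by apply/val_inj; rewrite /= -!fE ij.
move=> N'; apply: le_trans (_ : M%:R^-1 *+ N + d / 2 <= _); last first.
  by move: NM; rewrite -mulr_natl; lra.
apply: sum_dist_prefix.
- move=> i iN; rewrite massE iN -[lam i](mulKf (lt0r_neq0 M0)) [c i]lock.
  rewrite [_ / M%:R]mulrC -mulrBr normrM (@ger0_norm _ M%:R^-1) ?invr_ge0// -[leRHS]mulr1.
  rewrite ler_wpM2l ?invr_ge0//.
  have : (Num.truncn (M%:R * lam i))%:R <= M%:R * lam i < (Num.truncn (M%:R * lam i)).+1%:R.
    by apply: truncn_itv; rewrite mulr_ge0// ltW// len_gt0.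
  rewrite -lock /c -natr1 ler_norml => /andP[? ?].
  by apply/andP; split; lra.
- by move=> i Ni; rewrite massE ltnNge Ni mul0r.
- by apply/ltW/tail; rewrite /N -addnA leq_addr.
Qed.

Lemma dense_equidistributed (lam0 : simplex R) (d e : R) : 0 < d -> 0 < e ->
  exists (lam1 : simplex R) (r : R), [/\ 0 < r, l1_dist lam0 lam1 < d &
    forall mu, l1_dist lam1 mu < r -> equidistributed Pi mu e].
Proof.
move=> d0 e0; pose d' := d / 16; have d'0 : 0 < d' by rewrite divr_gt0.
(* Each error of [equidistributed_near] receives a third of [e]; [n0] serves both as [J] and as a
   lower bound for the number of cells. *)
pose n0 := (Num.truncn (3 / e)).+1.
have n0e : n0%:R^-1 <= e / 3.
  rewrite -[leRHS]invrK lef_pV2 ?posrE ?ltr0n ?invr_gt0 ?divr_gt0// invf_div.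
  by apply/ltW; exact: truncnS_gt.
have [X [key [lab [sigma [w [D w0 nX wd]]]]]] := count_approx lam0 n0 d'0.
have [|Y [key' [lab' [sigma' [om [D' om0 single XY omd]]]]]] :=
  @single_orbit_approx R Pi Pi_irr (size (enum X)) X key lab sigma (fun=> w)
    (enum X) d' D (fun=> erefl) (fun=> w0) _ (leqnn _) d'0.
  by move=> x; exists x; rewrite ?mem_enum.
have /choice [xg xgE] := lab_group D'.
pose rep g := lab' (xg g).
have repE g : group_of Pi (rep g) = g by exact: xgE.
have [t /(_ rep repE) drift] := drift_weights Pi_irr Pi_proper.
pose N0 := (\sum_y (lab' y).+1)%N.
have lab_lt y : (lab' y < N0)%N by rewrite /N0 (bigD1 y)//= addSn ltnS leq_addr.
have rep_lt g : (rep g < N0)%N by exact: lab_lt.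
pose Q := #|Y|; pose K := drift_bound t.
have Qn0 : (n0 <= Q)%N by apply: leq_trans XY.
have Q0 : (0 : R) < Q%:R by rewrite ltr0n (leq_trans _ Qn0).
pose B := bad_radius Y (margin t) (max_drift t).
pose A := (n0 * (4 * B) * max_drift t + 2 * B + K).+1.
have A0 : (0 : R) < A%:R by rewrite ltr0n.
(* The first bound keeps the drift over the relevant times below [omega] and the model lengths
   nonnegative, the second makes the total length accurate up to [e / 3], the third limits the
   perturbation to [d']. *)
pose s : R := Num.min (Num.min (2 * Q%:R * A%:R)^-1 (e / (3 * (margin t)%:R)))
                  (d' / K.+1%:R).
have L0 : (0 : R) < (margin t)%:R by rewrite ltr0n.
have s0 : 0 < s by rewrite !lt_min !divr_gt0 ?invr_gt0 ?mulr_gt0.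
have s1 : s <= (2 * Q%:R * A%:R)^-1 by rewrite !ge_min lexx.
have s2 : s * (margin t)%:R <= e / 3.
  rewrite -ler_pdivlMr// -mulrA -invfM; by rewrite !ge_min lexx orbT.
have s3 : s * K%:R <= d'.
  apply: (@le_trans _ _ (s * K.+1%:R)).
    by rewrite ler_pM2l ?ler_nat.
  by rewrite -ler_pdivlMr// !ge_min lexx !orbT.
have sA : s * A%:R <= (2 * Q%:R)^-1.
  by rewrite -ler_pdivlMr// -invfM.
have sK : s * K%:R <= (2 * Q%:R)^-1.
  by apply: le_trans sA; rewrite ler_pM2l// ler_nat ltnW// ltnS leq_addl.
have Q1 : (2 * Q%:R)^-1 <= 2^-1 :> R.
  rewrite lef_pV2 ?posrE ?mulr_gt0// ler_peMr// ler1n.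
  by rewrite (leq_trans _ Qn0).
pose kap : R := weight_in R rep t setT.
have kapK : `|s * kap| <= s * K%:R.
  by rewrite normrM gtr0_norm// ler_pM2l//; exact: weight_in_bound.
(* The cell width [om] is readjusted so that the model has total length exactly 1. *)
pose omega : R := (1 - s * kap) / Q%:R.
have omega_lo : (2 * Q%:R)^-1 <= omega.
  rewrite /omega invfM ler_pM2r ?invr_gt0//.
  by move: kapK; rewrite ler_norml => /andP[? ?]; lra.
have omega0 : 0 < omega by apply: lt_le_trans omega_lo; rewrite invr_gt0 mulr_gt0.
pose l0 := model_len lab' rep t omega s.
(* Nonzero weights sit on letters owning a cell, whose width [omega] outweighs them. *)
have l0_ge0 i : 0 <= l0 i.
  rewrite /l0 /model_len.
  have := weight_in_bound R rep t [set i]; rewrite -weight_atE => wK.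
  have swK : `|s * weight_at R rep t i| <= s * K%:R.
    by rewrite normrM gtr0_norm// ler_pM2l.
  have [[y yi]|none] := pselect (exists y, lab' y = i).
    have : omega * 1 <= omega * (cells_in lab' [set i])%:R.
      rewrite ler_pM2l// ler1n; apply/card_gt0P; exists y.
      by rewrite finset.in_set; apply/mem_set.
    by move: swK; rewrite ler_norml => /andP[? ?]; lra.
  rewrite /weight_at big_pred0.
    by rewrite mulr0 addr0; apply: mulr_ge0; [exact: ltW|exact: ler0n].
  by move=> g; apply/negP => /eqP gi; apply: none; exists (xg g).
have l0_out i : (N0 <= i)%N -> l0 i = 0 by exact: model_len_eq0.
have l0_sum : \sum_(i < N0) l0 i = 1.
  have := sum_model_len t lab_lt rep_lt omega s setT.
  rewrite (eq_bigl xpredT); last by move=> i; rewrite in_setT.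
  move=> ->; have -> : cells_in lab' setT = Q.
    by rewrite /Q -cardsT; apply: eq_card => x; rewrite !finset.in_set in_setT.
  by rewrite /omega mulfVK ?gt_eqF// subrK.
have l0_full N : (N0 <= N)%N -> \sum_(i < N) l0 i = 1.
  move=> /subnKC <-; rewrite big_split_ord /= l0_sum big1 ?addr0// => i _.
  by rewrite l0_out ?leq_addr.
have l0_partial N : \sum_(i < N) l0 i <= 1.
  rewrite -(l0_full (N + N0)%N (leq_addl _ _)) big_split_ord /= lerDl.
  exact: sumr_ge0.
pose c (i : nat) : R := (cells_in lab' [set i])%:R.
have massE i : mass lab' (fun=> om) i = om * c i.
  rewrite /mass /c cells_in_sum mulr_sumr; apply: eq_big => [y|y _]; last by rewrite mulr1.
  by apply/eqP/idP => [->|/set_mem//]; apply/mem_set.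
have lam0_mass N : \sum_(i < N) `|lam0 i - om * c i| <= 2 * d'.
  apply: (@le_trans _ _ (\sum_(i < N) (`|lam0 i - mass lab (fun=> w) i| +
      `|mass lab (fun=> w) i - mass lab' (fun=> om) i|))).
    by apply: ler_sum => i _; rewrite -massE; exact: ler_distD.
  rewrite big_split /=; have := wd N; have := omd N; lra.
have cells_le N : \sum_(i < N) c i <= Q%:R :> R.
  rewrite (eq_bigr (fun i : 'I_N => \sum_(y | lab' y == i) (1 : R))); last first.
    move=> i _; rewrite /c cells_in_sum; apply: eq_bigl => y.
    by apply/idP/eqP => [/set_mem//|->]; apply/mem_set.
  apply: le_trans (sum_fiber_le _ _ _) _ => //.
  by rewrite sumr_const.
have weight_le N : \sum_(i < N) `|weight_at R rep t i| <= K%:R.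
  apply: (@le_trans _ _ (\sum_(i < N) \sum_(g | rep g == i) `|(t g)%:~R : R|)).
    by apply: ler_sum => i _; exact: ler_norm_sum.
  apply: le_trans (sum_fiber_le _ _ _) _ => //.
  rewrite /K /drift_bound natr_sum; apply: ler_sum => g _.
  by rewrite natr_absz intr_norm.
have omQ : `|1 - om * Q%:R| <= 3 * d'.
  have [N1 tail] := simplex_tail lam0 d'0; pose N := (N0 + N1)%N.
  have := tail N (leq_addl _ _); have := simplex_partial lam0 N.
  have sumQ : \sum_(i < N) om * c i = om * Q%:R.
    rewrite -mulr_sumr; congr (_ * _); apply/eqP; rewrite eq_le cells_le /=.
    have -> : (Q%:R : R) = (cells_in lab' setT)%:R.
      by rewrite /Q -cardsT; congr _%:R; apply: eq_card => x; rewrite !finset.in_set in_setT.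
    have labN y : (lab' y < N)%N by exact: leq_trans (lab_lt y) (leq_addr _ _).
    rewrite cells_in_sum -(sum_fiber_set _ _ labN).
    rewrite big_mkcond /=; apply: ler_sum => i _; rewrite in_setT /c cells_in_sum.
    rewrite le_eqVlt; apply/orP; left; apply/eqP; apply: eq_bigl => y.
    by apply/eqP/idP => [->|/set_mem//]; apply/mem_set.
  have : `|\sum_(i < N) (lam0 i - om * c i)| <= 2 * d'.
    exact: le_trans (ler_norm_sum _ _ _) (lam0_mass N).
  rewrite sumrB sumQ !ler_norml => /andP[? ?] ? ?.
  by apply/andP; split; lra.
have lam0_l0 N : \sum_(i < N) `|lam0 i - l0 i| <= 8 * d'.
  apply: (@le_trans _ _ (\sum_(i < N) (`|lam0 i - om * c i| +
     (`|om - omega| * c i + s * `|weight_at R rep t i|)))).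
    apply: ler_sum => i _.
    have -> : `|om - omega| * c i = `|(om - omega) * c i|.
      by rewrite normrM [X in _ = _ * X]ger0_norm// ler0n.
    have -> : s * `|weight_at R rep t i| = `|s * weight_at R rep t i|.
      by rewrite normrM [X in _ = X * _]gtr0_norm.
    apply: (le_trans (ler_distD (om * c i) _ _)); rewrite lerD2l.
    apply: le_trans (ler_normB _ _); rewrite /l0 /model_len -/(c i) mulrBl.
    by rewrite opprD addrA.
  rewrite !big_split /= -!mulr_sumr.
  have := lam0_mass N.
  have : s * \sum_(i < N) `|weight_at R rep t i| <= s * K%:R by rewrite ler_pM2l.
  have : `|om - omega| * \sum_(i < N) c i <= `|om - omega| * Q%:R.
    by rewrite ler_wpM2l.
  have : `|om - omega| * Q%:R <= 3 * d' + s * K%:R.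
    rewrite -[X in _ * X](gtr0_norm Q0) -normrM mulrBl /omega mulfVK ?gt_eqF//.
    move: omQ kapK; rewrite !ler_norml => /andP[? ?] /andP[? ?].
    by apply/andP; split; lra.
  by move: s3; lra.
have lam0_l0_2 N : \sum_(i < N) `|lam0 i - l0 i| <= 2.
  apply: (@le_trans _ _ (\sum_(i < N) (lam0 i + l0 i))).
    apply: ler_sum => i _; apply: le_trans (ler_normB _ _) _.
    by rewrite gtr0_norm ?len_gt0// ger0_norm.
  by rewrite big_split /=; have := simplex_partial lam0 N; have := l0_partial N; lra.
(* Mixing in a proportion [th] of [lam0] makes all coordinates positive and moves the model by at
   most [2 * th], that is [s / 16]; a ball of radius [s / 16] uses up the rest of the tolerance
   [s / 8]. *)
pose th := s / 32.
have th0 : 0 < th by rewrite divr_gt0.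
have th1 : th <= 2^-1.
  have : s * 1 <= s * A%:R by rewrite ler_pM2l// ler1n.
  by rewrite /th; lra.
have th_ge0 : 0 <= 1 - th by move: th1; clear; lra.
have th_le1 : 1 - th <= 1 by move: th0; clear; lra.
have [||| lam1 lam1E] := @simplex_build R (fun i => (1 - th) * l0 i + th * lam0 i).
- move=> i; rewrite ltr_wpDl ?mulr_gt0 ?len_gt0// mulr_ge0//; lra.
- move=> N; rewrite big_split /= -!mulr_sumr.
  have : (1 - th) * \sum_(i < N) l0 i <= (1 - th) * 1 by rewrite ler_pM2l//; lra.
  have : th * \sum_(i < N) lam0 i <= th * 1 by rewrite ler_pM2l//; exact: simplex_partial.
  by lra.
- move=> e1 e1_gt0; have [N1 tail] := simplex_tail lam0 e1_gt0.
  exists (N0 + N1)%N; rewrite big_split /= -!mulr_sumr l0_full ?leq_addr// mulr1.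
  have : th * (1 - e1) <= th * \sum_(i < N0 + N1) lam0 i.
    by rewrite ler_pM2l//; apply/ltW/tail; rewrite leq_addl.
  have : th * e1 <= 1 * e1 by rewrite ler_pM2r//; lra.
  by lra.
exists lam1, (s / 16); split.
- by rewrite divr_gt0.
- apply: (@le_lt_trans _ _ (8 * d')); last by rewrite /d'; lra.
  apply: l1_dist_le => N; apply: le_trans (lam0_l0 N); apply: ler_sum => i _.
  rewrite lam1E.
  have -> : lam0 i - ((1 - th) * l0 i + th * lam0 i) = (1 - th) * (lam0 i - l0 i) by ring.
  by rewrite normrM (ger0_norm th_ge0); apply: ler_piMl.
move=> mu mu1.
have near N : \sum_(i < N) `|mu i - l0 i| <= s / 8.
  apply: (@le_trans _ _ (\sum_(i < N) (`|lam1 i - mu i| + th * `|lam0 i - l0 i|))).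
    apply: ler_sum => i _; rewrite -{1}(gtr0_norm th0) -normrM [`|lam1 i - mu i|]distrC.
    have -> : th * (lam0 i - l0 i) = lam1 i - l0 i by rewrite lam1E; ring.
    exact: ler_distD.
  rewrite big_split /= -mulr_sumr.
  have := l1_dist_partial lam1 mu N.
  have : th * \sum_(i < N) `|lam0 i - l0 i| <= th * 2 by rewrite ler_pM2l.
  by rewrite /th; lra.
have small : s * (n0 * (4 * B) * max_drift t + 2 * B)%:R <= omega.
  apply: le_trans omega_lo; apply: le_trans sA.
  by rewrite ler_pM2l// ler_nat /A ltnW// ltnS leq_addr.
have eqd := equidistributed_near D' single lab_lt rep_lt drift omega0 s0 near
  (ltn0Sn _ : (0 < n0)%N) small.
move=> nu nuI a a01; apply: le_trans (eqd nu nuI a a01) _.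
have : (#|Y|%:R)^-1 <= n0%:R^-1 :> R.
  by rewrite lef_pV2 ?posrE; [rewrite ler_nat|exact: Q0|rewrite ltr0n].
by move: n0e s2; clear; lra.
Qed.

End density.

Theorem theoremB (R : realType) (Pi : grouped_permutation)
    (Pi_proper : is_proper Pi) (Pi_irreducible : is_irreducible Pi) :
  exists S : set (simplex R),
    [/\ Gdelta S, dense S &
        S `<=` [set lam : simplex R | uniquely_ergodic Pi lam]].
Proof.
(* Interiors are taken to have open sets; they are dense because [dense_equidistributed] provides
   whole balls. *)
pose U n : set (simplex R) :=
  ([set lam | equidistributed Pi lam n.+1%:R^-1])°.
have Uo n : open (U n) by exact: open_interior.
exists (\bigcap_n U n); split; first by exists U.
- apply: simplex_Baire => // n O [lam0 Olam0] Oo.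
  have := open_nbhs_nbhs (conj Oo Olam0); move=> /nbhs_ballP[d /= d0 dO].
  have [|lam1 [r [r0 lam01 lam1r]]] :=
    dense_equidistributed Pi_irreducible Pi_proper lam0 d0 (e := n.+1%:R^-1).
    by rewrite invr_gt0.
  exists lam1; split; first by apply: dO; rewrite ball_simplex.
  apply/nbhs_ballP; exists r => //= mu; rewrite ball_simplex => /lam1r.
- move=> lam lamU; apply: uniquely_ergodic_equidistributed => n.
  exact: interior_subset (lamU n I).
Qed.
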